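(* Let $p$ be an odd prime and $H\cong\mathbb{Z}_p^5$. Let $A<\mathrm{Aut}(H)$ be a $p$-group such that $|C_{H_R}(A)|\ge p^2$. Then the S-ring $V(H,A)$ is a CI-S-ring.
   Context: $H$ is written additively. For $h\in H$, $h_R\in\mathrm{Sym}(H)$ is the translation $x\mapsto x+h$, $H_R=\{h_R:h\in H\}$, and $\mathrm{Aut}(H)$ is regarded as a subgroup of $\mathrm{Sym}(H)$; $C_{H_R}(A)$ is the set of elements of $H_R$ commuting with every element of $A$. For $S\subseteq H$, $\mathrm{Cay}(H,S)$ is the digraph on $H$ with arcs $(x,x+s)$, $x\in H$, $s\in S$. A Schur ring (S-ring) over $H$ is a subalgebra $\mathcal A$ of the group algebra $\mathbb{Q}H$ for which there is a partition $\mathrm{Bs}(\mathcal A)$ of $H$ (the basic sets) with $\{0\}\in\mathrm{Bs}(\mathcal A)$, $-T\in\mathrm{Bs}(\mathcal A)$ for each $T\in\mathrm{Bs}(\mathcal A)$, and $\mathcal A$ spanned by the elements $\underline{T}=\sum_{t\in T}t$, $T\in\mathrm{Bs}(\mathcal A)$. For $A\le\mathrm{Aut}(H)$, $V(H,A)$ denotes the S-ring whose basic sets are the $A$-orbits on $H$. $\mathrm{Aut}(\mathcal A)=\bigcap_{T\in\mathrm{Bs}(\mathcal A)}\mathrm{Aut}(\mathrm{Cay}(H,T))$. A bijection $f:H\to H$ is an isomorphism from $\mathcal A$ to an S-ring over $H$ if there is an S-ring $\mathcal B$ over $H$ with $\{\mathrm{Cay}(H,T)^f:T\in\mathrm{Bs}(\mathcal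 A)\}=\{\mathrm{Cay}(H,S):S\in\mathrm{Bs}(\mathcal B)\}$ (where $\mathrm{Cay}(H,T)^f$ is the image digraph under $f$); $\mathrm{Iso}(\mathcal A)$ is the set of all such $f$. $\mathcal A$ is a CI-S-ring if $\mathrm{Iso}(\mathcal A)=\mathrm{Aut}(\mathcal A)\,\mathrm{Aut}(H)$ (products of permutations). *)

(* Defs.v *)
From mathcomp Require Import all_boot all_order all_algebra all_fingroup all_solvable.
Set Implicit Arguments. Unset Strict Implicit. Unset Printing Implicit Defensive.
Import GRing.Theory.
Local Open Scope ring_scope.

Section SchurDefs.
Variable H : finZmodType.

Definition autH : {set {perm H}} :=
  [set f : {perm H} | [forall x : H, [forall y : H, f (x + y) == f x + f y]]].

Definition transl (h : H) : {perm H} := perm (addIr h).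

Definition HR : {set {perm H}} := [set transl h | h : H].

(* An S-ring over H, represented by its set of basic sets Bs(B):
   a partition of H (nonempty blocks) containing {0}, closed under T |-> -T,
   whose span of the elements T_ is closed under multiplication in QH, i.e.
   for basic sets T, S the coefficient of u in T_ * S_ (the number of pairs
   (t,s) in T x S with t + s = u) is constant on each basic set U. *)
Definition is_Sring (B : {set {set H}}) : bool :=
  [&& partition B [set: H],
      [set (0 : H)] \in B,
      [forall T in B, [set - x | x in T] \in B] &
      [forall T in B, forall S in B, forall U in B, forall u in U, forall v in U,
         #|[set ts : H * H | [&& ts.1 \in T, ts.2 \in S & ts.1 + ts.2 == u]]|
         == #|[set ts : H * H | [&& ts.1 \in T, ts.2 \in S & ts.1 + ts.2 == v]]| ]].

Definition VHA (A : {set {perm H}}) : {set {set H}} :=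
  [set orbit 'P A x | x : H].

Definition cay_arc (T : {set H}) (x y : H) : bool := (y - x) \in T.

Definition AutS (P : {set {set H}}) : {set {perm H}} :=
  [set f : {perm H} | [forall T in P, forall x : H, forall y : H,
      cay_arc T x y == cay_arc T (f x) (f y)]].

(* Iso(A): f such that {Cay(H,T)^f : T in Bs(A)} = {Cay(H,S) : S in Bs(B)}
   for some S-ring B over H.  Since f is a bijection,
   Cay(H,T)^f = Cay(H,S)  iff  forall x y, (x,y) arc of Cay(H,T) <-> (f x, f y) arc of Cay(H,S). *)
Definition cay_img_eq (f : {perm H}) (T S : {set H}) : bool :=
  [forall x : H, forall y : H, cay_arc T x y == cay_arc S (f x) (f y)].

Definition IsoS (P : {set {set H}}) : {set {perm H}} :=
  [set f : {perm H} | [exists B : {set {set H}},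
     [&& is_Sring B,
         [forall T in P, exists S in B, cay_img_eq f T S] &
         [forall S in B, exists T in P, cay_img_eq f T S]]]].

(* CI-S-ring: Iso(A) = Aut(A) Aut(H) (product of permutations, composed as
   right actions: (a * b) x = b (a x)). *)
Definition CI_Sring (P : {set {set H}}) : Prop :=
  IsoS P = (AutS P * autH)%g.

End SchurDefs.

Definition CHR (H : finZmodType) (A : {set {perm H}}) : {set {perm H}} :=
  ('C_(HR H)(A))%g.

(* Main.v *)
Require Import Defs.
From mathcomp Require Import all_boot all_order all_algebra all_fingroup all_solvable.
From mathcomp Require Import ring.

(** Let f be an isomorphism from V(H, A) with f(0) = 0.  It suffices to find a
    linear map s with f(v) in s(A v) for every v.

    The stabilizer of 0 in Aut(V(H, A)) is a p-group, since it acts by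
    translations on the factors of an A-invariant central chain.  By Schur's
    theorem on multipliers, f commutes with scalars on the set of orbits, so that
    the scalars and their conjugates under f are complements of this p-group in
    the same group; by Schur-Zassenhaus one may assume that f commutes with all
    scalars.  A map on F_p with this property is linear, and this makes f linear
    modulo Z = <e> + W, where W is a plane fixed pointwise by A and e is fixed
    modulo W.  After a linear change of f,
      f(x) = x + psi(x) e + phi(x), with psi(x) in F_p and phi(x) in W.

    If psi = 0, the condition on f says that phi is additive at v modulo
    D_v = {d in W : v + d in A v}, and the problem concerns two homogeneous
    functions on V / W, of dimension 3.  If psi <> 0, then for every v outside Z
    some element of A maps v to v + e modulo W, and comparing the values of f at
    x and x + e shows that psi is linear off a single direction of V / Z; with a
    basis of V / Z that contains this direction one may take s = 1. *)

Set Implicit Arguments. Unset Strict Implicit. Unset Printing Implicit Defensive.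
Import GRing.Theory.
Local Open Scope ring_scope.

Ltac vring := apply/rowP=> ?; rewrite !mxE; ring.

Lemma mem_eql (T : Type) (D : {pred T}) x y : y \in D -> x = y -> x \in D.
Proof. by move=> yD ->. Qed.

(** * Cyclotomic S-rings *)

Section CyclotomicSring.
Variable H : finZmodType.
Implicit Types (f g s : {perm H}) (A : {group {perm H}}) (x y u v : H).

Lemma autHP f : reflect {morph f : x y / x + y} (f \in autH H).
Proof.
rewrite inE; apply: (iffP forallP) => [fD x y | fD x].
  by have /forallP/(_ y)/eqP := fD x.
by apply/forallP=> y; rewrite fD.
Qed.

Lemma autH0 f : f \in autH H -> f 0 = 0.
Proof. by move/autHP=> fD; apply: (addrI (f 0)); rewrite -fD !addr0. Qed.

Lemma autHN f : f \in autH H -> {morph f : x / - x}.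
Proof.
move=> fH x; apply: (addrI (f x)).
by rewrite -(autHP _ fH) !subrr autH0.
Qed.

Lemma autHB f : f \in autH H -> {morph f : x y / x - y}.
Proof. by move=> fH x y; rewrite (autHP _ fH) (autHN fH). Qed.

Lemma autH_group_set : group_set (autH H).
Proof.
apply/group_setP; split=> [|f g /autHP fD /autHP gD]; apply/autHP=> x y.
  by rewrite !perm1.
by rewrite !permM fD gD.
Qed.
Canonical autH_group := Group autH_group_set.

Lemma translE x y : transl x y = y + x.
Proof. by rewrite permE. Qed.

Lemma orbP A x v : reflect (exists2 a, a \in A & v = a x) (v \in orbit 'P A x).
Proof.
by apply: (iffP orbitP) => -[a aA] => [<- | ->]; exists a.
Qed.

Lemma mem_VHA A T : reflect (exists x, T = orbit 'P A x) (T \in VHA A).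
Proof.
by apply: (iffP imsetP) => [[x _ ->] | [x ->]]; exists x.
Qed.

Lemma orb_perm A a x v : a \in A ->
  (a v \in orbit 'P A x) = (v \in orbit 'P A x).
Proof. exact: (orbit_actr 'P). Qed.

(** If [v = a u] with [a] in [A], then [a] carries the pairs with sum [u] onto those with sum [v]
    and keeps both terms in their orbits. *)
Lemma VHA_Sring A : A \subset autH H -> is_Sring (VHA A).
Proof.
move/subsetP=> sAH; apply/and4P; split.
- have := @orbit_partition _ _ _ 'P A [set: H].
  have -> : orbit 'P A @: [set: H] = VHA A.
    by apply/setP=> T; apply/imsetP/mem_VHA => [[x _ ->] | [x ->]]; exists x.
  by apply; apply/subsetP=> a _; rewrite !inE; apply/subsetP=> x _; rewrite !inE.
- apply/mem_VHA; exists 0; apply/setP=> x; rewrite inE.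
  apply/eqP/orbP => [-> | [a aA ->]]; last exact/autH0/sAH.
  by exists 1%g; rewrite ?perm1.
- apply/forall_inP=> _ /mem_VHA[x ->]; apply/mem_VHA; exists (- x).
  apply/setP=> y; apply/imsetP/orbP => [[_ /orbP[a aA ->] ->] | [a aA ->]].
    by exists a => //; rewrite (autHN (sAH a aA)).
  by exists (a x); [apply/orbP; exists a | rewrite (autHN (sAH a aA))].
apply/forall_inP=> T /mem_VHA[x1 ->]; apply/forall_inP=> S /mem_VHA[x2 ->].
apply/forall_inP=> U /mem_VHA[x3 ->]; apply/forall_inP=> u uU.
apply/forall_inP=> v vU; have: v \in orbit 'P A u.
  by rewrite orbit_sym in uU; apply: orbit_trans vU uU.
case/orbP=> a aA ->; apply/eqP.
pose h (ts : H * H) := (a ts.1, a ts.2).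
have hI : injective h by move=> [t1 t2] [s1 s2] [/perm_inj-> /perm_inj->].
rewrite -[RHS](card_preimset _ hI); apply: eq_card => -[t s]; rewrite !inE /=.
rewrite -(autHP _ (sAH a aA)) (inj_eq perm_inj).
by rewrite !orb_perm.
Qed.

Lemma orbJ A s x v : (s v \in orbit 'P (A :^ s)%g (s x)) = (v \in orbit 'P A x).
Proof.
apply/orbP/orbP => -[a].
  rewrite mem_conjg => aA; rewrite -{1}(permK s x) => sv.
  exists (a ^ s^-1)%g => //; rewrite /conjg invgK !permM.
  apply: (@perm_inj _ s); rewrite permKV sv ; congr (a _).
  by rewrite permK.
move=> aA ->; exists (a ^ s)%g; first by rewrite memJ_conjg.
by rewrite /conjg !permM permK.
Qed.

(** The S-ring reached by [g * s] is again cyclotomic: it is V(H, A^s), because [s] carries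
    [A]-orbits to orbits of [A :^ s]. *)
Lemma mulAutS_sub_IsoS A : A \subset autH H ->
  (AutS (VHA A) * autH H)%g \subset IsoS (VHA A).
Proof.
move=> sAH; apply/subsetP=> _ /mulsgP[g s gA sH ->]; rewrite inE.
have img x : cay_img_eq (g * s) (orbit 'P A x) (orbit 'P (A :^ s)%g (s x)).
  apply/forallP=> y; apply/forallP=> z; move: gA; rewrite inE.
  move/forall_inP/(_ (orbit 'P A x)) => gA.
  have /gA/forallP/(_ y)/forallP/(_ z)/eqP-> : orbit 'P A x \in VHA A.
    by apply/mem_VHA; exists x.
  by rewrite /cay_arc !permM -(autHB sH) orbJ.
apply/existsP; exists (VHA (A :^ s)%G); apply/and3P; split.
- apply: VHA_Sring; rewrite /= -(conjGid (sH : s \in autH_group)).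
  by rewrite conjSg.
- apply/forall_inP=> _ /mem_VHA[x ->]; apply/exists_inP.
  by exists (orbit 'P (A :^ s)%g (s x)) => //; apply/mem_VHA; exists (s x).
apply/forall_inP=> _ /mem_VHA[x ->]; apply/exists_inP.
exists (orbit 'P A (s^-1%g x)); first by apply/mem_VHA; exists (s^-1%g x).
by have := img (s^-1%g x); rewrite permKV.
Qed.

(** This form does not mention the target S-ring: once 0 is fixed, the basic set reached from the
    orbit of [v] can only be its image under [f]. *)
Definition orbit_iso (A : {set {perm H}}) (f : {perm H}) :=
  f 0 = 0 /\ forall x v, exists2 a, a \in A & f (x + v) = f x + f (a v).

(** The arcs leaving [f 0] identify the target basic set as the image of the orbit under [g]; those
    leaving [f x] then give the relation at [x]. *)
Lemma IsoS_orbit_iso A f : f \in IsoS (VHA A) ->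
  orbit_iso A (f * transl (- f 0))%g.
Proof.
set g := (f * _)%g => fI; have gE x : g x = f x - f 0 by rewrite permM translE.
split=> [|x v]; first by rewrite gE subrr.
move: fI; rewrite inE => /existsP[B /and3P[_ /forall_inP fB _]].
have /fB/exists_inP[S _ /forallP fS] : orbit 'P A v \in VHA A.
  by apply/mem_VHA; exists v.
pose u := g^-1%g (g (x + v) - g x).
have gu : g u = g (x + v) - g x by rewrite permKV.
have /orbP[a aA ua] : u \in orbit 'P A v.
  have /forallP/(_ u)/eqP := fS 0; rewrite /cay_arc subr0 => ->.
  rewrite -gE gu !gE opprB addrA subrK.
  have /forallP/(_ (x + v))/eqP := fS x.
  by rewrite /cay_arc addrAC subrr add0r => <-; rewrite orbit_refl.
by exists a; rewrite // -ua gu [RHS]addrC subrK.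
Qed.

(** In [f = (f * s^-1) * s] the first factor preserves the Cayley digraph of every orbit, since
    [f z - f y] is [s] of a point in the orbit of [z - y]. *)
Lemma linear_mulAutS A f s : A \subset autH H -> orbit_iso A (f * transl (- f 0))%g ->
    s \in autH H -> (forall v, exists2 a, a \in A & f v - f 0 = s (a v)) ->
  f \in (AutS (VHA A) * autH H)%g.
Proof.
move=> sAH [_ fA] sH fs; rewrite -(mulgKV s f); apply: mem_mulg => //.
rewrite inE; apply/forall_inP=> _ /mem_VHA[x ->].
apply/forallP=> y; apply/forallP=> z; rewrite /cay_arc !permM.
have sVH : s^-1%g \in autH_group by rewrite groupV.
have [a aA] := fA y (z - y); rewrite !permM !translE [y + _]addrC subrK.
have [b bA ->] := fs (a (z - y)).
move/(canRL (subrK _)); rewrite addrAC subrK => ->.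
rewrite -(autHB sVH) [f y + _]addrC addrK permK -permM.
by rewrite permM !orb_perm.
Qed.

End CyclotomicSring.

(** * Multipliers *)

Lemma pFrobenius_sum_comm (R : nzRingType) q (charRq : q \in [pchar R])
    (I : Type) (r : seq I) (P : pred I) (F : I -> R) :
    (forall i j, F i * F j = F j * F i) ->
  (\sum_(i <- r | P i) F i) ^+ q = \sum_(i <- r | P i) F i ^+ q.
Proof.
move=> cF; rewrite -(pFrobenius_autE charRq).
elim: r => [|i r IH]; first by rewrite !big_nil pFrobenius_aut0.
rewrite !big_cons; case: (P i) => //.
rewrite pFrobenius_autD_comm ?IH ?pFrobenius_autE //.
by apply: commr_sum => j _; apply: cF.
Qed.

Section Multiplier.
Variables (H : finZmodType) (n q : nat) (e : 'I_n.+1 -> H) (e' : H -> 'I_n.+1).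
Hypotheses (eK : cancel e e') (e'K : cancel e' e) (q_pr : prime q).
Implicit Types (T S : {set H}) (s t u : H).

(** Adjacency matrices of Cayley digraphs, with [H] numbered by [e]. Coefficients are taken mod [q]
    so that the [q]-th power is additive on commuting matrices. *)
Let adj T : 'M['F_q]_n.+1 := \matrix_(i, j) (e j - e i \in T)%:R.
Let shift t : 'M['F_q]_n.+1 := \matrix_(i, j) (e j - e i == t)%:R.

Let pchar_mx : q \in [pchar 'M['F_q]_n.+1].
Proof.
rewrite inE /= q_pr /= -(rmorph_nat (@scalar_mx _ _)) pchar_Fp_0 //.
by rewrite rmorph0.
Qed.

Let adj_shift T : adj T = \sum_(t in T) shift t.
Proof.
apply/matrixP=> i j; rewrite summxE mxE.
under eq_bigr do rewrite mxE.
have [dT | dnT] := boolP (e j - e i \in T).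
  rewrite (bigD1 (e j - e i)) //= eqxx big1 ?addr0 // => t /andP[_ /negbTE].
  by rewrite eq_sym => ->.
by rewrite big1 // => t tT; case: eqP dnT => // ->; rewrite tT.
Qed.

Let shiftM s t : shift s * shift t = shift (s + t).
Proof.
apply/matrixP=> i k; rewrite -mulmxE !mxE (bigD1 (e' (e i + s))) //= !mxE.
rewrite e'K [_ + s - _]addrAC subrr add0r eqxx mul1r big1 ?addr0 => [|j].
  by rewrite opprD addrA subr_eq [t + s]addrC.
rewrite !mxE; case: (e j - e i =P s) => [<- | _ _]; last by rewrite mul0r.
by rewrite addrC subrK eK eqxx.
Qed.

Let shiftX t m : shift t ^+ m = shift (t *+ m).
Proof.
elim: m => [|m IH]; last by rewrite exprS IH shiftM mulrS.
apply/matrixP=> i j; rewrite !mxE subr_eq0 (can_eq eK).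
by rewrite eq_sym.
Qed.

(* Modulo q, the q-th power of the adjacency matrix of Cay(H, T) is the adjacency
   matrix of Cay(H, qT). *)
Lemma sum_prime_tuples_invariant (f : {perm H}) T S : f 0 = 0 ->
    injective (fun x : H => x *+ q) ->
    (forall x y, (y - x \in T) = (f y - f x \in S)) ->
  forall u, (u \in [set t *+ q | t in T]) = (f u \in [set s *+ q | s in S]).
Proof.
move=> f0 qI fTS u.
have adjX T' u' : (adj T' ^+ q) (e' 0) (e' u') = (u' \in [set t *+ q | t in T'])%:R.
  rewrite adj_shift (pFrobenius_sum_comm pchar_mx) => [|s t]; last first.
    by rewrite !shiftM addrC.
  rewrite summxE; under eq_bigr do rewrite shiftX mxE !e'K subr0.
  have [/imsetP[t tT ->] | u'nT] := boolP (_ \in _).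
    rewrite (bigD1 t) //= eqxx big1 ?addr0 // => s /andP[_ /negbTE].
    by rewrite (inj_eq qI) eq_sym => ->.
  rewrite big1 // => t tT; case: eqP u'nT => // -> /negP[].
  exact: imset_f.
(* As an isomorphism of digraphs, [f] matches all powers of the two adjacency matrices. *)
have adjf m i j : (adj T ^+ m) i j = (adj S ^+ m) (e' (f (e i))) (e' (f (e j))).
  elim: m i j => [|m IH] i j.
    by rewrite !expr0 !mxE (inj_eq (can_inj e'K)) (inj_eq perm_inj) (can_eq eK).
  rewrite !exprS -!mulmxE !mxE.
  rewrite [RHS](reindex (fun k => e' (f (e k)))) /=; last first.
    exists (fun k => e' (f^-1%g (e k))) => k _; first by rewrite e'K permK eK.
    by rewrite e'K permKV eK.
  by apply: eq_bigr => k _; rewrite IH !mxE !e'K fTS.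
have := adjf q (e' 0) (e' u); rewrite !e'K f0 !adjX.
by do 2!case: (_ \in _) => // /eqP; rewrite ?oner_eq0 // eq_sym oner_eq0.
Qed.
End Multiplier.

(** * The stabilizer of 0 is a p-group *)

Section Translations.
Variable H : finZmodType.
Implicit Types (x y v : H).

Lemma translD x y : transl (x + y) = (transl x * transl y)%g.
Proof. by apply/permP=> z; rewrite permM !translE addrA. Qed.

Lemma transl0 : transl (0 : H) = 1%g.
Proof. by apply/permP=> z; rewrite perm1 translE addr0. Qed.

Lemma translN x : transl (- x) = (transl x)^-1%g.
Proof. by apply/eqP; rewrite eq_sym eq_invg_mul -translD subrr transl0. Qed.

Lemma transl_inj : injective (@transl H).
Proof. by move=> x y /permP/(_ 0); rewrite !translE !add0r. Qed.

Lemma HR_group_set : group_set (HR H).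
Proof.
apply/group_setP; split; first by rewrite -transl0 imset_f.
by move=> _ _ /imsetP[x _ ->] /imsetP[y _ ->]; rewrite -translD imset_f.
Qed.
Canonical HR_group := Group HR_group_set.

Lemma card_HR : #|HR H| = #|H|.
Proof. by rewrite card_imset //; apply: transl_inj. Qed.

Lemma translJ a v : a \in autH H -> (transl v ^ a)%g = transl (a v).
Proof.
move/autHP=> aD; apply/permP=> z.
by rewrite /conjg !permM !translE aD permKV.
Qed.

End Translations.

Section UnipotentChain.
Variables (H : finZmodType) (p : nat) (A : {group {perm H}}).
Hypotheses (sAH : A \subset autH H) (pH : p.-nat #|H|) (pA : (p.-group A)%g).

(** The translations and [A] generate a [p]-group, which is nilpotent. The chain consists of the
    translations in its lower central series, because the commutator of [transl v] and [a] is the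
    translation by [a v - v]. *)
Lemma unipotent_chain : exists2 L : nat -> pred H,
    [/\ forall v, L 0 v, forall i, zmod_closed (L i)
      & forall i a v, a \in A -> L i v -> L i.+1 (a v - v)]
  & exists m, forall v, L m v -> v = 0.
Proof.
pose G := (HR H <*> A)%G.
have nHA : A \subset 'N(HR H)%g.
  apply/subsetP=> a aA; rewrite inE; apply/subsetP=> _ /imsetP[_ /imsetP[v _ ->] ->].
  by rewrite translJ ?(subsetP sAH) // imset_f.
have pG : (p.-group G)%g.
  rewrite /= norm_joinEr // (pgroupM p (HR_group H)) pA andbT.
  by rewrite /pgroup card_HR.
have [sHG sAG] := (joing_subl (HR H) A, joing_subr (HR H) A).
have tG v : transl v \in G by rewrite (subsetP sHG) ?imset_f.
(* The lower central series starts at index 1, so that [L 0] is all of [H]. *)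
exists (fun i => [pred v | transl v \in 'L_i.+1(G)%g]).
  split=> [v | i | i a v aA] /=; first by rewrite lcn1.
    split=> [|u v uL vL] /=; first by rewrite inE transl0 group1.
    by rewrite inE translD translN groupM ?groupV.
  move=> vL; rewrite addrC translD translN -(translJ _ (subsetP sAH a aA)).
  by rewrite -commgEl lcnSn mem_commg // (subsetP sAG).
have /lcnP[m Lm] := pgroup_nil pG.
exists m => v /=; rewrite Lm => /set1P; rewrite -transl0.
exact: transl_inj.
Qed.

End UnipotentChain.

Section OrbitalStabilizer.
Variables (H : finZmodType) (A : {group {perm H}}).
Implicit Types (g f : {perm H}) (x v : H).

(** The stabilizer of 0 in Aut(V(H, A)). *)
Definition orbital_stab : {set {perm H}} :=
  [set g : {perm H} | (g 0 == 0) && [forall x, forall v, g (x + v) - g x \in orbit 'P A v]].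

Lemma orbital_stabP g :
  reflect (g 0 = 0 /\ forall x v, exists2 a, a \in A & g (x + v) = g x + a v)
          (g \in orbital_stab).
Proof.
rewrite inE; apply: (iffP andP) => [[/eqP g0 /forallP gA] | [-> gA]]; split=> //.
  move=> x v; have /forallP/(_ v)/orbP[a aA ga] := gA x.
  by exists a; rewrite // -ga [RHS]addrC subrK.
apply/forallP=> x; apply/forallP=> v; have [a aA ->] := gA x v.
by rewrite addrC addKr; apply/orbP; exists a.
Qed.

Lemma orbital_stab_orb g v : g \in orbital_stab -> exists2 a, a \in A & g v = a v.
Proof.
by case/orbital_stabP=> g0 /(_ 0 v)[a aA]; rewrite g0 !add0r => ->; exists a.
Qed.

Lemma orbital_stab_group_set : group_set orbital_stab.
Proof.
apply/group_setP; split=> [|g h /orbital_stabP[g0 gA] /orbital_stabP[h0 hA]].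
  by apply/orbital_stabP; split=> [|x v]; [|exists 1%g]; rewrite ?perm1.
apply/orbital_stabP; split=> [|x v]; rewrite !permM ?g0 //.
have [a aA ->] := gA x v; have [b bA ->] := hA (g x) (a v).
by exists (a * b)%g; rewrite ?groupM // permM.
Qed.
Canonical orbital_stab_group := Group orbital_stab_group_set.

Lemma orbit_iso_mull g f :
  g \in orbital_stab -> orbit_iso A f -> orbit_iso A (g * f)%g.
Proof.
move=> gS [f0 fA]; have gVS : g^-1%g \in orbital_stab_group by rewrite groupV.
have [g0 gA] := orbital_stabP _ gS; split=> [|x v]; rewrite !permM ?g0 //.
have [a aA ->] := gA x v; have [b bA ->] := fA (g x) (a v).
have [c cA gc] := orbital_stab_orb (b (a v)) gVS.
by exists (a * b * c)%g; rewrite ?groupM // !permM -gc permKV.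
Qed.

Variable p : nat.
Hypotheses (p_pr : prime p) (pE : forall x : H, x *+ p = 0).
Hypotheses (sAH : A \subset autH H) (pA : (p.-group A)%g).

Lemma elementary_pnat_card : p.-nat #|H|.
Proof.
rewrite -cardsT -[p.-nat _]/(p.-group [set: H])%g -pnat_exponent.
apply: (pnat_dvd _ (pnat_id p_pr)); apply/exponentP=> x _.
by rewrite FinRing.zmodXgE pE.
Qed.

(** By induction on [i], the power [g ^+ (p ^ i)] moves every point by an element of [L i]; hence
    [g ^+ (p ^ m)] is trivial. *)
Lemma pgroup_orbital_stab : (p.-group orbital_stab)%g.
Proof.
have [L [L0 Lz LS] [m Lm]] := unipotent_chain sAH elementary_pnat_card pA.
have LB i : {in L i &, forall u v, u - v \in L i} by case: (Lz i).
have L0' i : 0 \in L i by case: (Lz i).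
have LN i u : u \in L i -> - u \in L i.
  by move=> uL; rewrite -sub0r LB.
have LD i u v : u \in L i -> v \in L i -> u + v \in L i.
  by move=> uL vL; rewrite -[v]opprK LB ?LN.
suff gX i g x : g \in orbital_stab -> (g ^+ (p ^ i))%g x - x \in L i.
  rewrite -[orbital_stab]/(gval orbital_stab_group) -pnat_exponent.
  apply: (@pnat_dvd _ (p ^ m)); last by rewrite pnatX pnat_id.
  apply/exponentP=> g gS; apply/permP=> x; rewrite perm1; apply/eqP.
  by rewrite -subr_eq0; apply/eqP/Lm/gX.
move=> gS; elim: i x => [|i IH] x; first exact: L0.
set h := (g ^+ _)%g in IH; have hS : h \in orbital_stab_group by apply: groupX.
rewrite expnSr expgM -/h.
(* For [d] in [L i], [h (x + d)] is [h x + d] modulo [L i.+1]. So [h ^+ j] moves [x] by [j] times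
   the displacement of [h], and [p] kills this. *)
suff hX j : (h ^+ j)%g x - x - (h x - x) *+ j \in L i.+1.
  by have := hX p; rewrite pE subr0.
elim: j => [|j IHj]; first by rewrite expg0 perm1 subrr subr0 L0'.
have hjX : (h ^+ j)%g x - x \in L i.
  elim: (j) => [|l IHl]; first by rewrite expg0 perm1 subrr L0'.
  by rewrite expgSr permM -(subrK ((h ^+ l)%g x) (h _)) -addrA LD ?IH.
have [_ /(_ x ((h ^+ j)%g x - x))[a aA]] := orbital_stabP _ hS.
rewrite [x + _]addrC subrK expgSr permM => ->.
set y := (h ^+ j)%g x in IHj hjX *.
have -> : h x + a (y - x) - x - (h x - x) *+ j.+1
  = (a (y - x) - (y - x)) + (y - x - (h x - x) *+ j).
  rewrite addrA subrK mulrS opprD addrA; congr (_ - _).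
  by rewrite [h x + _ - x]addrAC [_ + a _]addrC addrK.
by rewrite LD //; apply: LS.
Qed.

End OrbitalStabilizer.

(** * Reduction to maps commuting with scalars *)

Section OrbitMultiples.
Variables (H : finZmodType) (A : {group {perm H}}).
Hypothesis sAH : A \subset autH H.
Implicit Types (T : {set H}) (f : {perm H}) (x v : H).

Definition dilate (k : nat) T : {set H} := [set t *+ k | t in T].

Lemma autHMn a k x : a \in autH H -> a (x *+ k) = a x *+ k.
Proof.
move=> aH; elim: k => [|k IH]; first exact: autH0.
by rewrite !mulrS (autHP _ aH) IH.
Qed.

Lemma dilate_orbit k v : dilate k (orbit 'P A v) = orbit 'P A (v *+ k).
Proof.
apply/setP=> x; apply/imsetP/orbP => [[_ /orbP[a aA ->] ->] | [a aA ->]].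
  by exists a; rewrite ?autHMn // (subsetP sAH).
exists (a v); first by apply/orbP; exists a.
by rewrite autHMn // (subsetP sAH).
Qed.

Lemma dilateM k l T : dilate (k * l) T = dilate k (dilate l T).
Proof. by rewrite /dilate -imset_comp; apply: eq_imset => x /=; rewrite mulnC mulrnA. Qed.

Lemma orbit_iso_mem f x v w : orbit_iso A f ->
  (w - x \in orbit 'P A v) = (f w - f x \in f @: orbit 'P A v).
Proof.
move=> [_ fA]; have [a aA] := fA x (w - x).
rewrite [x + _]addrC subrK => ->; rewrite [f x + _]addrC addrK.
by rewrite mem_imset ?orb_perm //; apply: perm_inj.
Qed.

Variable p : nat.
Hypotheses (p_pr : prime p) (pE : forall x : H, x *+ p = 0).

Lemma mulrn_coprime_inj k : coprime k p -> injective (fun x : H => x *+ k).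
Proof.
move=> kp x y /eqP; rewrite -subr_eq0 -mulrnBl => /eqP xyk.
have /eqP d1 : #[x - y]%g == 1%N.
  by rewrite -dvdn1 -(eqP kp) dvdn_gcd !order_dvdn !FinRing.zmodXgE pE xyk eqxx.
by apply/eqP; rewrite -subr_eq0 -order_eq1 d1.
Qed.

(** Schur's theorem on multipliers: the prime factors of [k] are below [p], hence coprime to it, and
    [sum_prime_tuples_invariant] handles them one at a time. *)
Lemma image_dilate f k v : orbit_iso A f -> (0 < k < p)%N ->
  f @: dilate k (orbit 'P A v) = dilate k (f @: orbit 'P A v).
Proof.
move=> fA; have [m] := ubnP k; elim: m k v => // m IH k v; rewrite ltnS => le_km.
case/andP=> k0 ltkp; have [k1 | k1] := leqP k 1.
  have -> : k = 1 by apply/eqP; rewrite eqn_leq k1.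
  have d1 T : dilate 1 T = T by rewrite /dilate (eq_imset _ (@mulr1n _)) imset_id.
  by rewrite !d1.
have q_pr := pdiv_prime k1; set q := pdiv k in q_pr.
have kE : k = (q * (k %/ q))%N by rewrite mulnC divnK ?pdiv_dvd.
have l0 : (0 < k %/ q)%N by rewrite divn_gt0 ?(prime_gt0 q_pr) // pdiv_leq.
have ltlk : (k %/ q < k)%N by rewrite ltn_Pdiv ?(prime_gt1 q_pr).
rewrite kE !dilateM -(IH _ _ (leq_trans ltlk le_km)) ?l0 ?(ltn_trans ltlk) //.
rewrite dilate_orbit; set w := v *+ _.
have qp : coprime q p.
  rewrite coprime_sym prime_coprime // gtnNdvd ?prime_gt0 //.
  exact: leq_ltn_trans (pdiv_leq k0) ltkp.
have [n Hn] : exists n, #|H| = n.+1.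
  by exists #|H|.-1; rewrite prednK //; apply/card_gt0P; exists 0.
pose e (i : 'I_n.+1) : H := enum_val (cast_ord (esym Hn) i).
pose e' (x : H) : 'I_n.+1 := cast_ord Hn (enum_rank x).
have eK : cancel e e' by move=> i; rewrite /e /e' enum_valK cast_ordKV.
have e'K : cancel e' e by move=> x; rewrite /e /e' cast_ordK enum_rankK.
have qT := sum_prime_tuples_invariant eK e'K q_pr (proj1 fA) (mulrn_coprime_inj qp)
  (fun x y => orbit_iso_mem x w y fA).
apply/setP=> x; rewrite -[x](permKV f) mem_imset; last exact: perm_inj.
by rewrite [LHS]qT.
Qed.

End OrbitMultiples.

Section Homogenization.
Variables (p n : nat) (A : {group {perm 'rV['F_p]_n}}).
Hypotheses (p_pr : prime p) (sAH : A \subset autH _) (pA : (p.-group A)%g).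
Local Notation V := 'rV['F_p]_n.
Implicit Types (f g : {perm V}) (x v : V) (u : {unit 'F_p}).

Lemma Fp_scale_mulrn (k : 'F_p) v : k *: v = v *+ k.
Proof. by rewrite -scaler_nat natr_Zp. Qed.

Lemma Fp_mulrn v : v *+ p = 0.
Proof. by rewrite -scaler_nat pchar_Fp_0 // scale0r. Qed.

Lemma autHZ (a : {perm V}) (k : 'F_p) v : a \in autH _ -> a (k *: v) = k *: a v.
Proof. by move=> aH; rewrite !Fp_scale_mulrn autHMn. Qed.

Lemma Fp_unit_neq0 u : val u != 0.
Proof. by rewrite -unitfE (valP u). Qed.

Definition homothety u : {perm V} := perm (can_inj (scalerK (Fp_unit_neq0 u))).

Definition homotheties : {set {perm V}} := [set homothety u | u : {unit 'F_p}].

Lemma homothetyE u v : homothety u v = val u *: v.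
Proof. by rewrite permE. Qed.

Lemma homotheties_group_set : group_set homotheties.
Proof.
apply/group_setP; split=> [|_ _ /imsetP[u _ ->] /imsetP[w _ ->]].
  by apply/imsetP; exists 1%g => //; apply/permP=> v; rewrite perm1 homothetyE scale1r.
apply/imsetP; exists (w * u)%g => //; apply/permP=> v.
by rewrite permM !homothetyE scalerA.
Qed.
Canonical homotheties_group := Group homotheties_group_set.

Lemma coprime_card_homotheties : coprime p #|homotheties|.
Proof.
rewrite prime_coprime // gtnNdvd ?(cardG_gt0 homotheties_group) //.
apply: leq_ltn_trans (leq_imset_card _ _) _.
rewrite -[X in (_ < X)%N](card_Fp p_pr) card_sub.
apply: proper_card; apply/properP; split; first exact/subsetP.
by exists 0 => //; rewrite !inE unitr0.
Qed.

Lemma Fp_image_scale f v (k : 'F_p) : orbit_iso A f -> k != 0 ->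
  f @: orbit 'P A (k *: v)%R = [set k *: y | y in f @: orbit 'P A v].
Proof.
move=> fA k0; rewrite Fp_scale_mulrn -dilate_orbit // (image_dilate sAH p_pr) //.
- by apply: eq_imset => y; rewrite Fp_scale_mulrn.
- exact: Fp_mulrn.
by rewrite lt0n k0 /= -[X in (_ < X)%N](card_Fp p_pr) card_ord.
Qed.

(** The product [h] satisfies [f (val u *: h x) = val u *: f x]. As [f] commutes with scalars on
    orbits, [h (x + v) - h x] stays in the orbit of [v]. *)
Lemma homothety_commutator f u : orbit_iso A f ->
  (f * homothety u * f^-1 * (homothety u)^-1)%g \in orbital_stab A.
Proof.
move=> fA; set h := (_ * _)%g; have [f0 fD] := fA.
have hE x : f (val u *: h x) = val u *: f x.
  rewrite -[val u *: h x]homothetyE -[homothety u (h x)]permM mulgKV.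
  by rewrite !permM permKV homothetyE.
have u0 := Fp_unit_neq0 u.
rewrite inE; apply/andP; split.
  rewrite -(inj_eq (scalerI u0)) scaler0 -(inj_eq (@perm_inj _ f)) hE f0.
  by rewrite scaler0.
apply/forallP=> x; apply/forallP=> v; have [a aA fx] := fD x v.
have uD : val u *: (h (x + v) - h x) \in orbit 'P A (val u *: v)%R.
  rewrite scalerBr (orbit_iso_mem _ _ _ fA) !hE fx scalerDr [X in X - _]addrC addrK.
  by rewrite Fp_image_scale // !imset_f // orb_perm ?orbit_refl.
have /orbP[b bA hb] := uD; apply/orbP; exists b => //.
by apply: (scalerI u0); rewrite hb autHZ ?(subsetP sAH).
Qed.

Lemma homothety_norm : homotheties \subset 'N(orbital_stab A)%g.
Proof.
apply/subsetP=> _ /imsetP[u _ ->]; rewrite inE.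
apply/subsetP=> _ /imsetP[g /orbital_stabP[g0 gA] ->].
have u0 := Fp_unit_neq0 u.
have gE x : (g ^ homothety u)%g (val u *: x) = val u *: g x.
  by rewrite -!homothetyE /conjg !permM permK.
apply/orbital_stabP; split=> [|x v].
  by have := gE 0; rewrite g0 !scaler0.
rewrite -(scalerKV u0 x) -(scalerKV u0 v) -scalerDr !gE.
have [a aA ->] := gA ((val u)^-1 *: x) ((val u)^-1 *: v).
by exists a => //; rewrite (autHZ (val u) _ (subsetP sAH _ aA)) scalerDr.
Qed.

(* The homotheties form a complement of the p-group [orbital_stab A], and so
   does their conjugate under f; by Schur-Zassenhaus these are conjugate. *)
Lemma homogenize f : orbit_iso A f -> exists2 g, g \in orbital_stab A &
  forall (k : 'F_p) x, (g * f)%g (k *: x) = k *: (g * f)%g x.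
Proof.
move=> fA.
have pS : (p.-group (orbital_stab A))%g by apply: pgroup_orbital_stab Fp_mulrn _ _.
have coS : coprime #|orbital_stab A| #|homotheties|.
  have /p_natP[m ->] := pS.
  by rewrite coprimeXl // coprime_card_homotheties.
have sK : (homotheties :^ f^-1)%g \subset (orbital_stab A * homotheties)%g.
  apply/subsetP=> _ /imsetP[_ /imsetP[u _ ->] ->].
  rewrite /conjg invgK -(mulgKV (homothety u) (_ * _)%g) mem_mulg ?imset_f //.
  by rewrite !mulgA; apply: homothety_commutator.
have solS : solvable (orbital_stab_group A) by apply: pgroup_sol pS.
have [g gS Kg] := SchurZassenhaus_trans_sol (K := homotheties_group)
  (K1 := (homotheties :^ f^-1)%G) solS homothety_norm sK coS (cardJg _ _).
exists g => // k x; have fgA := orbit_iso_mull gS fA.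
have [-> | k0] := eqVneq k 0; first by rewrite !scale0r (proj1 fgA).
have uk : k \is a GRing.unit by rewrite unitfE.
pose u := FinRing.unit 'F_p uk.
set m := homothety u; set fg := (g * f)%g.
have fmK : (fg * m * fg^-1)%g \in homotheties.
  have : ((m ^ f^-1) ^ g^-1)%g \in ((homotheties :^ f^-1) :^ g^-1)%g.
    by rewrite !memJ_conjg imset_f.
  have -> : (homotheties :^ f^-1)%g = (homotheties :^ g)%g := Kg.
  rewrite conjsgK.
  by rewrite /conjg /fg invMg !invgK !mulgA.
(* Since [fg] normalizes the homotheties, this commutator lies in two subgroups of coprime orders;
   it is trivial, and [fg] commutes with [m]. *)
have : (fg * m * fg^-1 * m^-1)%g \in orbital_stab A :&: homotheties.
  rewrite inE homothety_commutator //= (groupM fmK) // groupV imset_f //.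
rewrite (coprime_TIg coS) => /set1P fgm.
have : (fg * m)%g = (m * fg)%g.
  by apply: (mulIg fg^-1%g); rewrite mulgK; apply: (mulIg m^-1%g); rewrite fgm mulgV.
by move/permP/(_ x); rewrite !permM !homothetyE.
Qed.

End Homogenization.

(** * Homogeneous functions and their additive directions *)

Lemma span_neq_full p n (X : seq 'rV['F_p]_n) : (size X < n)%N -> <<X>>%VS != fullv.
Proof.
move=> ltXn; apply: contraTneq (dim_span X) => ->.
by rewrite dimvf /dim /= mul1n -ltnNge.
Qed.

Lemma span2P p n (u1 u2 v : 'rV['F_p]_n) : v \in <<[:: u1; u2]>>%VS ->
  exists k l, v = k *: u1 + l *: u2.
Proof.
move=> vP; rewrite (@coord_span _ _ _ [tuple u1; u2] _ vP).
by rewrite !big_ord_recl big_ord0 addr0; do 2!eexists.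
Qed.

Section LinearForms.
Variables p n : nat.
Local Notation F := 'F_p.
Local Notation U := 'rV[F]_n.
Implicit Types (g phi : U -> F) (x o : U) (k l m : F).

Definition homogeneous g := forall k x, g (k *: x) = k * g x.
Definition linear_form g := forall k x y, g (k *: x + y) = k * g x + g y.
Definition additive_at g o := [forall x, g (x + o) == g x + g o].

Lemma additive_atP g o :
  reflect (forall x, g (x + o) = g x + g o) (additive_at g o).
Proof. by apply: (iffP forallP) => go x; apply/eqP/go. Qed.

Lemma additive_at_scale g o k x : homogeneous g -> additive_at g o ->
  g (x + k *: o) = g x + k * g o.
Proof.
move=> gZ /additive_atP go; rewrite -[k]natr_Zp.
elim: (k : nat) x => [|j IH] x; first by rewrite scale0r mul0r !addr0.
by rewrite -natr1 scalerDl scale1r addrA go IH; ring.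
Qed.

Lemma additive_atZ g o k : homogeneous g -> additive_at g o -> additive_at g (k *: o).
Proof.
by move=> gZ go; apply/additive_atP=> x; rewrite gZ additive_at_scale.
Qed.

Lemma additive_atD g o1 o2 :
  additive_at g o1 -> additive_at g o2 -> additive_at g (o1 + o2).
Proof.
move=> /additive_atP g1 /additive_atP g2; apply/additive_atP=> x.
by rewrite addrA !g2 g1 addrA.
Qed.

Lemma linear_formZ g k x : linear_form g -> g (k *: x) = k * g x.
Proof.
move=> gL; have g0 : g 0 = 0.
  by apply: (addIr (g 0)); have := gL 1 0 0; rewrite scaler0 addr0 mul1r add0r.
by rewrite -[k *: x]addr0 gL g0 addr0.
Qed.

Lemma linear_formD g : linear_form g -> {morph g : x y / x + y}.
Proof. by move=> gL x y; rewrite -{1}[x]scale1r gL mul1r. Qed.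

Lemma linear_form_additive g : homogeneous g -> (forall o, additive_at g o) -> linear_form g.
Proof.
move=> gZ ga k x y; rewrite addrC additive_at_scale // addrC //.
Qed.

(* The places where g is additive form a subspace, on which g is linear. *)
Lemma linear_extension g : homogeneous g ->
  exists2 s, linear_form s & forall o, additive_at g o -> s o = g o.
Proof.
move=> gZ; pose X := [seq o <- enum U | additive_at g o]; pose P := <<X>>%VS.
have Pa o : o \in P -> additive_at g o.
  move=> oP; rewrite (@coord_span _ _ _ (in_tuple X) _ oP); elim/big_ind: _ => [|x y|i _].
  - by apply/additive_atP=> x; rewrite -(scale0r 0) gZ mul0r scale0r !addr0.
  - exact: additive_atD.
  apply: additive_atZ => //.
  have: X`_i \in X by rewrite mem_nth.
  by rewrite mem_filter => /andP[].
exists (g \o projv P) => [k x y | o go] /=.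
  rewrite linearP /= addrC additive_at_scale 1?addrC //.
  by apply: Pa; rewrite memv_proj.
by rewrite projv_id // memv_span // mem_filter go mem_enum.
Qed.

End LinearForms.

(** * Simultaneous linearization of two homogeneous functions on F_p^3 *)

Section CommonLinearization.
Variable p : nat.
Local Notation F := 'F_p.
Local Notation U := 'rV[F]_3.
Implicit Types (g phi : U -> F) (x o : U) (k l m : F).

Lemma coord_free3 (o1 o2 o3 : U) : free [:: o1; o2; o3] ->
  exists c : 'I_3 -> U -> F, (forall i, linear_form (c i)) /\
    [/\ forall x, x = c 0 x *: o1 + c 1 x *: o2 + c 2%:R x *: o3,
        [/\ c 0 o1 = 1, c 1 o1 = 0 & c 2%:R o1 = 0],
        [/\ c 0 o2 = 0, c 1 o2 = 1 & c 2%:R o2 = 0] &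
        [/\ c 0 o3 = 0, c 1 o3 = 0 & c 2%:R o3 = 1]].
Proof.
pose X := [tuple o1; o2; o3] => Xfree.
have Xb : basis_of fullv X.
  by rewrite basisEfree Xfree subvf dimvf /dim /= mul1n.
exists (fun i => coord X i); split=> [i k x y |]; first by rewrite linearP.
split=> [x|||]; last 3 first.
- by rewrite !(@coord_free _ _ _ X 0).
- by rewrite !(@coord_free _ _ _ X 1).
- by rewrite !(@coord_free _ _ _ X 2%:R).
rewrite [LHS](coord_basis Xb (memvf x)) !big_ord_recl big_ord0 addr0 addrA.
by congr (_ + _ + _); congr (coord _ _ _ *: _); apply/val_inj.
Qed.

Lemma notin_span (X : seq U) : (size X < 3)%N -> exists o, o \notin <<X>>%VS.
Proof.
move/span_neq_full; rewrite eqEsubv subvf /= => /subvPn[o _ oX].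
by exists o.
Qed.

(** Greedy choice from [o3] to [o1]: a new vector is taken in [O] unless [O] lies in the span so
    far, and is arbitrary in that case. If this ever happens, [O] lies in the span of [o2] and
    [o3]. *)
Lemma adapted_basis3 (O : pred U) : exists o1 o2 o3, free [:: o1; o2; o3] /\
  ([/\ O o1, O o2 & O o3] \/ forall o, O o -> o \in <<[:: o2; o3]>>%VS).
Proof.
have step (X : seq U) : free X -> (size X < 3)%N ->
    exists2 o, free (o :: X) & O o \/ forall x, O x -> x \in <<X>>%VS.
  move=> Xf /notin_span[o oX]; have [/existsP[x] | nX] :=
    boolP [exists x, O x && (x \notin <<X>>%VS)].
    by case/andP=> Ox xX; exists x; [rewrite free_cons xX | left].
  exists o; first by rewrite free_cons oX.
  right=> x Ox; apply: contraNT nX => xX; apply/existsP; exists x.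
  by rewrite Ox.
have [o3 f3 O3] := step [::] (nil_free _) isT.
have [o2 f2 O2] := step _ f3 isT; have [o1 f1 O1] := step _ f2 isT.
exists o1, o2, o3; split=> //.
have [O1' | O1'] := O1; last by right.
have O23 x y Y : x \in <<Y>>%VS -> x \in <<y :: Y>>%VS.
  by rewrite span_cons; apply/subvP; apply: addvSr.
have [O2' | O2'] := O2; last by right=> x /O2'; apply: O23.
have [O3' | O3'] := O3; first by left.
by right=> x /O3' xn; apply/O23/O23.
Qed.

Lemma additive_of_coordinates g (c : 'I_3 -> U -> F) a1 a2 a3 :
    (forall i, linear_form (c i)) ->
    (forall x, g x = c 0 x * a1 + c 1 x * a2 + c 2%:R x * a3) ->
  forall o, additive_at g o.
Proof.
move=> cL gE o; apply/additive_atP=> x; rewrite !gE.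
by rewrite -[x in x + o]scale1r !cL; ring.
Qed.

Section Pencil.
Variables phi1 phi2 : U -> F.
Hypotheses (phi1Z : homogeneous phi1) (phi2Z : homogeneous phi2).

Definition pencil l m x := l * phi1 x + m * phi2 x.

Lemma pencilZ l m : homogeneous (pencil l m).
Proof. by move=> k x; rewrite /pencil phi1Z phi2Z; ring. Qed.

Lemma pencil_parallel l m l' m' o : (l != 0) || (m != 0) -> l' * m = l * m' ->
  additive_at (pencil l m) o -> additive_at (pencil l' m') o.
Proof.
move=> lm0 lm /additive_atP go; apply/additive_atP=> x.
have [k [-> ->]] : exists k, l' = k * l /\ m' = k * m.
  have [l0 | l0] := eqVneq l 0.
    rewrite l0 eqxx /= in lm lm0; exists (m' / m); rewrite l0 mulfVK // mulr0.
    by split=> //; apply: (mulIf lm0); rewrite lm !mul0r.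
  exists (l' / l); rewrite mulfVK //; split=> //.
  by apply: (mulfI l0); rewrite -lm; field.
have kE y : pencil (k * l) (k * m) y = k * pencil l m y by rewrite /pencil; ring.
by rewrite !kE go mulrDr.
Qed.

(** A member not proportional to the linear one expresses [phi2] through both, so [phi2] is additive
    wherever that member is. Hence [s2] extends [phi2] from its additive directions, and [s1] is
    solved from [l * s1 + m * s2 = pencil l m]. *)
Lemma linear_member_linearization l m : l != 0 ->
    (forall o, additive_at (pencil l m) o) ->
  exists s1 s2, [/\ linear_form s1, linear_form s2 &
    forall l' m' o, additive_at (pencil l' m') o ->
      l' * s1 o + m' * s2 o = pencil l' m' o].
Proof.
move=> l0 gA; have gL := linear_form_additive (pencilZ l m) gA.
have [s sL sP] := linear_extension phi2Z.
exists (fun x => (pencil l m x - m * s x) / l), s; split=> // [k x y|l' m' o].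
  by rewrite gL sL; field.
move/additive_atP=> lo; have [d0 | d0] := eqVneq (m' * l) (l' * m).
  have -> : m' = l' * m / l by rewrite -d0 mulfK.
  by rewrite /pencil; field.
have {}d0 : m' * l - l' * m != 0 by rewrite subr_eq0.
rewrite sP; first by rewrite /pencil; field.
apply/additive_atP=> x; apply: (mulfI d0).
have dE y : (m' * l - l' * m) * phi2 y = l * pencil l' m' y - l' * pencil l m y.
  by rewrite /pencil; ring.
by rewrite mulrDr !dE lo (additive_atP _ _ (gA o)); ring.
Qed.

End Pencil.

Lemma linear_member_linearization_sym phi1 phi2 l m :
    homogeneous phi1 -> homogeneous phi2 -> (l != 0) || (m != 0) ->
    (forall o, additive_at (pencil phi1 phi2 l m) o) ->
  exists s1 s2, [/\ linear_form s1, linear_form s2 &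
    forall l' m' o, additive_at (pencil phi1 phi2 l' m') o ->
      l' * s1 o + m' * s2 o = pencil phi1 phi2 l' m' o].
Proof.
move=> phi1Z phi2Z /orP[l0 | m0] lA.
  exact: linear_member_linearization l0 lA.
have pC l' m' o : additive_at (pencil phi1 phi2 l' m') o ->
    additive_at (pencil phi2 phi1 m' l') o.
  move/additive_atP=> lo; apply/additive_atP=> x.
  by have := lo x; rewrite /pencil ![l' * _ + _]addrC.
have [s2 [s1 [s2L s1L sP]]] :=
  linear_member_linearization phi2Z phi1Z m0 (fun o => pC _ _ _ (lA o)).
exists s1, s2; split=> // l' m' o /pC/sP.
by rewrite /pencil addrC => ->; rewrite addrC.
Qed.

Section CommonMember.
Variables phi1 phi2 : U -> F.
Local Notation P := (pencil phi1 phi2).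

(* Three independent directions of additivity belonging to pairwise
   non-proportional members of the pencil force a linear member; otherwise all
   such directions lie in a plane, where it suffices to agree on a basis. *)
Lemma common_linearization : homogeneous phi1 -> homogeneous phi2 ->
  exists s1 s2, [/\ linear_form s1, linear_form s2 &
    forall l m o, additive_at (P l m) o ->
      l * s1 o + m * s2 o = P l m o].
Proof.
move=> phi1Z phi2Z.
have PZ := pencilZ phi1Z phi2Z.
pose O := [pred o | [exists l, [exists m,
  ((l != 0) || (m != 0)) && additive_at (P l m) o]]].
have [o1 [o2 [o3 [oF oO]]]] := adapted_basis3 O.
have [c [cL [cE [c01 c11 c21] [c02 c12 c22] [c03 c13 c23]]]] := coord_free3 oF.
case: oO => [[O1 O2 O3] | Oplane].
  have /existsP[l1 /existsP[m1 /andP[lm1 A1]]] := O1.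
  have /existsP[l2 /existsP[m2 /andP[lm2 A2]]] := O2.
  have /existsP[l3 /existsP[m3 /andP[lm3 A3]]] := O3.
  (* If the second and third members are proportional, one member is additive at both [o2] and [o3];
     homogeneity along [o1] then makes it linear. *)
  have [d0 | d0] := eqVneq (l3 * m2 - l2 * m3) 0.
    have A3' : additive_at (P l2 m2) o3.
      by apply: pencil_parallel A3 => //; apply/esym/eqP; rewrite -subr_eq0 d0.
    apply: (linear_member_linearization_sym phi1Z phi2Z lm2).
    apply: (additive_of_coordinates (a1 := P l2 m2 o1) (a2 := P l2 m2 o2)
      (a3 := P l2 m2 o3) cL) => x.
    rewrite [in LHS](cE x) (additive_at_scale _ _ (PZ _ _) A3').
    by rewrite (additive_at_scale _ _ (PZ _ _) A2) PZ.
  apply: (linear_member_linearization_sym phi1Z phi2Z lm1).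
  apply: (additive_of_coordinates (a1 := P l1 m1 o1) (a2 := P l1 m1 o2)
      (a3 := P l1 m1 o3) cL) => x.
  rewrite [in LHS](cE x) -addrA addrC.
  rewrite (additive_at_scale _ _ (PZ _ _) A1).
  set b := c 1 x; set d := c _ x.
  (* The first member combines the other two, which are additive at [o2] and [o3] respectively. So
     it is linear on their span, and it is additive at [o1]. *)
  have PE y : (l3 * m2 - l2 * m3) * P l1 m1 y =
      (l3 * m1 - l1 * m3) * P l2 m2 y + (l1 * m2 - l2 * m1) * P l3 m3 y.
    by rewrite /pencil; ring.
  have : P l1 m1 (b *: o2 + d *: o3) = b * P l1 m1 o2 + d * P l1 m1 o3.
    apply: (mulfI d0); rewrite PE (additive_at_scale _ _ (PZ _ _) A3) PZ.
    rewrite [b *: _ + _]addrC (additive_at_scale _ _ (PZ _ _) A2) PZ.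
    rewrite [RHS]mulrDr !(mulrCA (l3 * m2 - l2 * m3)) !PE; ring.
  by move->; ring.
have sL i j a b : linear_form (fun x => c i x * a + c j x * b).
  by move=> k x y; rewrite !cL; ring.
(* In the plane case the forms agree with [phi1] and [phi2] at [o2] and [o3] and vanish at [o1]. *)
exists (fun x => c 1 x * phi1 o2 + c 2%:R x * phi1 o3).
exists (fun x => c 1 x * phi2 o2 + c 2%:R x * phi2 o3); split=> // l m o Ao.
have -> : l * (c 1 o * phi1 o2 + c 2%:R o * phi1 o3) +
   m * (c 1 o * phi2 o2 + c 2%:R o * phi2 o3) = c 1 o * P l m o2 + c 2%:R o * P l m o3.
  by rewrite /pencil; ring.
have [/andP[/eqP-> /eqP->] | lm0] := boolP ((l == 0) && (m == 0)).
  by rewrite /pencil !mul0r addr0 !mulr0 addr0.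
have /Oplane/span2P[b [d oE]] : O o.
  by apply/existsP; exists l; apply/existsP; exists m; rewrite -negb_and lm0.
have -> : c 1 o = b by rewrite oE cL linear_formZ // c12 c13 mulr0 addr0 mulr1.
have -> : c 2%:R o = d by rewrite oE cL linear_formZ // c22 c23 mulr0 add0r mulr1.
have [b0 | b0] := eqVneq b 0; first by rewrite oE b0 scale0r add0r PZ mul0r add0r.
(* Solving for [o2] brings in the additivity at [o]: the value at [o2] follows from those at [o3]
   and [o]. *)
have -> : o2 = - (d / b) *: o3 + b^-1 *: o.
  by rewrite oE; apply/rowP=> i; rewrite !mxE; field.
by rewrite (additive_at_scale _ _ (PZ _ _) Ao) PZ; field.
Qed.

End CommonMember.

End CommonLinearization.

(** * Maps that are linear modulo <e> + W *)

Section NormalizedIso.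
Variables (p n : nat) (A : {group {perm 'rV['F_p]_n}}).
Hypotheses (p_pr : prime p) (p_odd : odd p) (sAH : A \subset autH _).
Local Notation F := 'F_p.
Local Notation V := 'rV[F]_n.
Variables (W : {vspace V}) (e : V).
Hypotheses (eW : e \notin W).
Hypothesis (AW : forall a w, a \in A -> w \in W -> a w = w).
Hypothesis (Ae : forall a, a \in A -> a e - e \in W).
Implicit Types (a : {perm V}) (x v w d : V) (k : F).

(* The subgroup D_v. *)
Definition Wstab v := [pred d | (d \in W) && (v + d \in orbit 'P A v)].

Let aD a x v : a \in A -> a (x + v) = a x + a v.
Proof. by move=> aA; apply/autHP/(subsetP sAH). Qed.

Let aZ a k v : a \in A -> a (k *: v) = k *: a v.
Proof. by move=> aA; apply: autHZ => //; apply: (subsetP sAH). Qed.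

Lemma WstabP v d : reflect (d \in W /\ exists2 a, a \in A & a v = v + d) (d \in Wstab v).
Proof.
apply: (iffP andP) => -[dW].
  by case/orbP=> a aA ->; split=> //; exists a.
by case=> a aA vd; split=> //; apply/orbP; exists a.
Qed.

Lemma Wstab_zmod v : zmod_closed (Wstab v).
Proof.
split=> [|c d /WstabP[cW [a aA ac]] /WstabP[dW [b bA bd]]].
  by apply/WstabP; split; [exact: mem0v | exists 1%g; rewrite // perm1 addr0].
apply/WstabP; split; first exact: rpredB.
exists (b^-1 * a)%g; first by rewrite groupM ?groupV.
have bV : b^-1%g \in A by rewrite groupV.
have bv : b^-1%g v = v - d.
  by rewrite -[in RHS](permK b v) bd (aD _ _ bV) (AW bV dW) addrK.
by rewrite permM bv (aD _ _ aA) ac (AW aA) ?rpredN //; vring.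
Qed.

Lemma Wstab0 v : 0 \in Wstab v. Proof. by case: (Wstab_zmod v). Qed.

Lemma WstabB v c d : c \in Wstab v -> d \in Wstab v -> c - d \in Wstab v.
Proof. by case: (Wstab_zmod v) => _; apply. Qed.

Lemma WstabD v c d : c \in Wstab v -> d \in Wstab v -> c + d \in Wstab v.
Proof.
by move=> cW dW; rewrite -[d]opprK WstabB // -sub0r WstabB ?Wstab0.
Qed.

Lemma WstabZ v k d : d \in Wstab v -> k *: d \in Wstab v.
Proof.
move=> dW; rewrite Fp_scale_mulrn; elim: (k : nat) => [|j IH]; first exact: Wstab0.
by rewrite mulrS WstabD.
Qed.

Lemma Wstab_orb a v w : a \in A -> w \in W -> Wstab (a v + w) =i Wstab v.
Proof.
have sub b u t : b \in A -> t \in W -> {subset Wstab u <= Wstab (b u + t)}.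
  move=> bA tW d /WstabP[dW [c cA cd]]; apply/WstabP; split=> //.
  exists (b^-1 * c * b)%g; first by rewrite !groupM ?groupV.
  have bV : b^-1%g \in A by rewrite groupV.
  rewrite !permM (aD _ _ bV) permK (AW bV tW) (aD _ _ cA) cd (AW cA tW).
  by rewrite !(aD _ _ bA) (AW bA tW) (AW bA dW); vring.
move=> aA wW d; apply/idP/idP; last exact: sub.
have aV : a^-1%g \in A by rewrite groupV.
move/(sub a^-1%g _ (- w) aV); rewrite rpredN => /(_ wW).
by rewrite (aD _ _ aV) permK (AW aV wW) addrK.
Qed.

Lemma orb_addWstab v u d : u \in orbit 'P A v -> d \in Wstab v -> u + d \in orbit 'P A v.
Proof.
case/orbP=> a aA -> /andP[dW vd]; rewrite -[d](AW aA dW) -(aD _ _ aA).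
by rewrite orb_perm.
Qed.

(** If [a v = v + x + c], the inverse of [a] fixes [W] pointwise and so sends [v + x + d] to
    [v + (d - c)]. *)
Lemma Wstab_sub_orb v x c d : c \in W -> d \in W ->
  v + x + c \in orbit 'P A v -> v + x + d \in orbit 'P A v -> d - c \in Wstab v.
Proof.
move=> cW dW /orbP[a aA ac] /orbP[b bA bd]; apply/WstabP; split.
  exact: rpredB.
have aV : a^-1%g \in A by rewrite groupV.
exists (b * a^-1)%g; first by rewrite groupM.
have dcW : d - c \in W by apply: rpredB.
rewrite permM -bd -[X in _ = _ + X](AW aV dcW) -[X in _ = X + _](permK a) -(aD _ _ aV).
by rewrite -ac; congr (a^-1%g _); vring.
Qed.

Lemma e_inj j k w w' : w \in W -> w' \in W -> j *: e + w = k *: e + w' -> j = k /\ w = w'.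
Proof.
move=> wW w'W jk; have jkE : (j - k) *: e = w' - w.
  by rewrite scalerBl -[j *: e](addrK w) jk; vring.
have [jk0 | jk0] := eqVneq (j - k) 0.
  move/eqP: jk0 jkE; rewrite subr_eq0 => /eqP->; rewrite subrr scale0r.
  by move/eqP; rewrite eq_sym subr_eq0 => /eqP->.
case/negP: eW; rewrite -[e](scalerK jk0) jkE.
by rewrite rpredZ // rpredB.
Qed.

(* The k-th power of a shear v |-> v + e + c1, e |-> e + c2 adds this to v + k e. *)
Definition shear_offset k c1 c2 : V := k *: c1 + (k * (k - 1) / 2%:R) *: c2.

Lemma two_neq0 : 2%:R != 0 :> F.
Proof.
by rewrite -(dvdn_pcharf (pchar_Fp p_pr)) gtnNdvd // odd_prime_gt2.
Qed.

Lemma shear_pow a v c : a \in A -> a v = v + e + c -> c \in W -> forall k,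
  exists2 b, b \in A & b v = v + k *: e + shear_offset k c (a e - e).
Proof.
move=> aA av cW k; rewrite -[k]natr_Zp.
(* Passing from [j] to [j.+1] adds [j] times [a e - e], whence the coefficient [k * (k - 1) / 2];
   dividing by 2 is possible as [p] is odd. *)
suff [b [bA bv be]] : exists b, [/\ b \in A,
  b v = v + (k : nat)%:R *: e + shear_offset (k : nat)%:R c (a e - e) &
  b e = e + (k : nat)%:R *: (a e - e)] by exists b.
elim: (k : nat) => [|j [b [bA bv be]]].
  exists 1%g; rewrite group1 !perm1 /shear_offset; split=> //; last by vring.
  by rewrite !scale0r !mul0r scale0r !addr0.
exists (b * a)%g; rewrite groupM // !permM bv be.
set c2 := a e - e in bv be *; have c2W : c2 \in W by apply: Ae.
have ae : a e = e + c2 by rewrite /c2; vring.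
have gW : shear_offset j%:R c c2 \in W by rewrite rpredD ?rpredZ.
split=> //.
  rewrite (aD _ _ aA) (aD _ _ aA) av (aZ _ _ aA) ae (AW aA) //.
  rewrite /shear_offset -natr1; apply/rowP=> i; rewrite !mxE; field.
  exact: two_neq0.
by rewrite (aD _ _ aA) ae (aZ _ _ aA) (AW aA) // -natr1; vring.
Qed.

(** * The components [psi] and [phi] of [f - 1] *)

Section Defect.
Variables (f : V -> V) (psi : V -> F) (phi : V -> V).
Hypotheses (fA : forall x v, exists2 a, a \in A & f (x + v) = f x + f (a v)).
Hypotheses (fZ : forall k x, f (k *: x) = k *: f x).
Hypotheses (fE : forall x, f x = x + psi x *: e + phi x).
Hypotheses (phiW : forall x, phi x \in W).
Hypotheses (fe : f e = e) (fW : forall w, w \in W -> f w = w).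

Let uniq j k x w w' : w \in W -> w' \in W ->
  x + j *: e + w = x + k *: e + w' -> j = k /\ w = w'.
Proof. by move=> wW w'W; rewrite -!addrA => /addrI; apply: e_inj. Qed.

Lemma defect_fix x : f x = x -> psi x = 0 /\ phi x = 0.
Proof.
move=> fx; apply: (@uniq _ _ x); rewrite ?mem0v //.
by rewrite -fE fx scale0r !addr0.
Qed.

Lemma defectZ k x : psi (k *: x) = k * psi x /\ phi (k *: x) = k *: phi x.
Proof.
apply: (@uniq _ _ (k *: x)); rewrite ?rpredZ //.
by rewrite -fE fZ fE; vring.
Qed.

Lemma defectDW x w : w \in W -> psi (x + w) = psi x /\ phi (x + w) = phi x.
Proof.
move=> wW; apply: (@uniq _ _ (x + w)); rewrite // -fE.
by have [a aA ->] := fA x w; rewrite (AW aA) // (fW wW) fE; vring.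
Qed.

(** As [a e] lies in [e + W], which [f] fixes pointwise, [f (x + e)] is [f x + e] up to [W]. *)
Lemma psiDe x : psi (x + e) = psi x.
Proof.
have [a aA] := fA x e; have aeW := Ae aA.
have -> : a e = e + (a e - e) by vring.
have [psie phie] := defectDW e aeW; have [psi0 phi0] := defect_fix fe.
rewrite fE [f x]fE [f (e + _)]fE psie phie psi0 phi0 => fxe.
have wW : phi x + (a e - e) \in W by rewrite rpredD.
suff /(uniq (phiW _) wW)[] : x + e + psi (x + e) *: e + phi (x + e) =
  x + e + psi x *: e + (phi x + (a e - e)) by [].
by rewrite fxe; vring.
Qed.

Lemma psiDZ x k : psi (x + k *: e) = psi x.
Proof.
rewrite Fp_scale_mulrn; elim: (k : nat) => [|j IH]; first by rewrite addr0.
by rewrite mulrSr addrA psiDe.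
Qed.

Definition dpsi x v := psi (x + v) - psi x - psi v.

(** The point is [a v], solved from [f (x + v) = f x + f (a v)]. It lies in [v + <e> + W], so
    [psi (a v) = psi v], and this identifies the coefficient of [e] as [dpsi x v]. *)
Lemma defect_orbit x v :
  v + dpsi x v *: e + (phi (x + v) - phi x - phi (v + dpsi x v *: e)) \in orbit 'P A v.
Proof.
have [a aA fxv] := fA x v; apply/orbP; exists a => //.
have avE : a v = v + (psi (x + v) - psi x - psi (a v)) *: e + (phi (x + v) - phi x - phi (a v)).
  transitivity (f x + f (a v) - f x - psi (a v) *: e - phi (a v)).
    by rewrite (fE (a v)); vring.
  by rewrite -fxv !fE; vring.
set i := psi _ - _ - _ in avE; set d := phi _ - _ - _ in avE.
have dW : d \in W by rewrite !rpredB.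
have [psiav phiav] := defectDW (v + i *: e) dW.
rewrite -avE psiDZ in psiav; rewrite -avE in phiav.
have <- : i = dpsi x v by rewrite /i psiav.
by rewrite -phiav -avE.
Qed.

(** Two points of the orbit of [v] lie in [v + k *: e + W], one from [defect_orbit] and one from a
    power of the shear [a]; their difference is in [D_v]. Stating [k] by an equation allows
    [dpsi x v] to stand for [dpsi x (v + e)] when the base point is [v + e]. *)
Lemma Wstab_phi x v a c k : a \in A -> c \in W -> a v = v + e + c -> k = dpsi x v ->
  phi (x + v) - phi x - phi (v + k *: e) - shear_offset k c (a e - e) \in Wstab v.
Proof.
move=> aA cW av ->; have [b bA bv] := shear_pow aA av cW (dpsi x v).
apply: (@Wstab_sub_orb v (dpsi x v *: e)).
- by rewrite rpredD ?rpredZ ?Ae.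
- by rewrite !rpredB.
- by rewrite -bv; apply/orbP; exists b.
exact: defect_orbit.
Qed.

Lemma dpsiDe x v k : dpsi x (v + k *: e) = dpsi x v.
Proof. by rewrite /dpsi addrA !psiDZ. Qed.

(* The increment of phi along e is, modulo D_v, determined by psi: this is
   obtained by comparing [defect_orbit] at v and at v + e. *)
Definition kappa x := phi (x + e) - phi x.

(** [Wstab_phi] is compared at [x] and [x + e]: both have the same [dpsi], so the terms that do not
    come from [kappa] cancel. *)
Lemma kappa_sub v a c x : a \in A -> c \in W -> a v = v + e + c ->
  kappa (x + v) - kappa x \in Wstab v.
Proof.
move=> aA cW av; have P1 := Wstab_phi (x := x) aA cW av erefl.
have := Wstab_phi (x := x + e) aA cW av erefl.
have -> : dpsi (x + e) v = dpsi x v by rewrite /dpsi [x + e + v]addrAC !psiDe.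
move=> P2; apply: (mem_eql (WstabB P2 P1)).
by rewrite /kappa [x + e + v]addrAC; vring.
Qed.

Lemma kappa_self v a c : a \in A -> c \in W -> a v = v + e + c -> kappa v \in Wstab v.
Proof.
move=> aA cW av; apply: (mem_eql (kappa_sub 0 aA cW av)).
rewrite /kappa !add0r (defect_fix (fW (mem0v W))).2 (defect_fix fe).2.
by rewrite !subr0.
Qed.

(** Up to [W], [v + k *: e] lies in the orbit of [v]; so it has the same group [D_v], and [a] also
    moves it by [e] modulo [W]. *)
Lemma kappa_line v a c k : a \in A -> c \in W -> a v = v + e + c ->
  kappa (v + k *: e) \in Wstab v.
Proof.
move=> aA cW av; have [b bA bv] := shear_pow aA av cW k.
set g := shear_offset _ _ _ in bv; have gW : g \in W by rewrite rpredD ?rpredZ ?Ae.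
have vE : v + k *: e = b v - g by rewrite bv addrK.
rewrite -(Wstab_orb v bA (w := - g)) ?rpredN // -vE.
apply: (kappa_self aA (c := c + k *: (a e - e))).
  by rewrite rpredD ?rpredZ ?Ae.
by rewrite (aD _ _ aA) (aZ _ _ aA) av; vring.
Qed.

(** [Wstab_phi] is compared at [v] and [v + e]. For [v + e] the constant [c] becomes
    [c + (a e - e)], so the offset grows by [dpsi x v *: (a e - e)]; what remains are values of
    [kappa] known modulo [D_v]. *)
Lemma kappa_dpsi v a c x : a \in A -> c \in W -> a v = v + e + c ->
  kappa x - dpsi x v *: (a e - e) \in Wstab v.
Proof.
move=> aA cW av; have cW' : c + (a e - e) \in W by rewrite rpredD ?Ae.
have ave : a (v + e) = v + e + e + (c + (a e - e)).
  by rewrite (aD _ _ aA) av; vring.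
have k0E : dpsi x v = dpsi x (v + e) by rewrite -[in RHS](scale1r e) dpsiDe.
have := Wstab_phi (x := x) aA cW' ave k0E.
have eE : v + e = a v - c by rewrite av addrK.
rewrite {3}eE (Wstab_orb v aA) ?rpredN // => P1.
have P2 := Wstab_phi (x := x) aA cW av erefl.
have P3 := kappa_line (dpsi x v) aA cW av; have P4 := kappa_sub x aA cW av.
apply: (mem_eql (WstabB (WstabD (WstabB P1 P2) P3) P4)).
rewrite /kappa /shear_offset (addrA x) [v + e + _]addrAC; move: (_ / 2%:R) => b; vring.
Qed.

Variables (b1 b2 : V).
Hypotheses (fb1 : f b1 = b1) (fb2 : f b2 = b2).
Hypothesis (spanV : forall v, exists k l j w,
  w \in W /\ v = k *: b1 + l *: b2 + j *: e + w).

(* The directions v along which the increment of phi along e need not vanish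
   modulo D_v. *)
Definition twisted v := exists a, [/\ a \in A, a v - v - e \in W & a e - e \notin Wstab v].

(** Modulo [D], [G] takes at [k' *: c1 + l' *: c2], up to [<e> + W], the value [(l' / l) *: G v].
    Since [G c2 = 0], this puts [G v] in [D], and with it all values. *)
Lemma additive_at_span (D : pred V) (G : V -> V) v (c1 c2 : V) (k l : F) z :
    zmod_closed D -> (forall m x, G (m *: x) = m *: G x) ->
    (forall x j w, w \in W -> G (x + j *: e + w) - G x \in D) ->
    G c1 = 0 -> G c2 = 0 -> (forall x, G (x + v) - G x - G v \in D) ->
    (forall x, exists k' l' j w, w \in W /\ x = k' *: c1 + l' *: c2 + j *: e + w) ->
    v = k *: c1 + l *: c2 + z -> (exists j w, w \in W /\ z = j *: e + w) -> l != 0 ->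
  forall x, G x \in D.
Proof.
move=> [D0 DB] GZ Gz Gc1 Gc2 Gv spanc vE [j [w [wW zE]]] l0.
have DD u t : u \in D -> t \in D -> u + t \in D.
  by move=> uD tD; rewrite -[t]opprK DB // -sub0r DB.
have DZ m t : t \in D -> m *: t \in D.
  move=> tD; rewrite Fp_scale_mulrn; elim: (m : nat) => // i IH.
  by rewrite mulrS DD.
have GvZ m x : G (x + m *: v) - G x - m *: G v \in D.
  rewrite !Fp_scale_mulrn; elim: (m : nat) => [|i IH].
    by apply: (mem_eql D0); rewrite !mulr0n addr0; vring.
  apply: (mem_eql (DD _ _ (Gv (x + v *+ i)) IH)).
  by rewrite !mulrSr addrA; vring.
have Gt k' l' j' w' : w' \in W ->
    G (k' *: c1 + l' *: c2 + j' *: e + w') - (l' / l) *: G v \in D.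
  move=> w'W; set t := l' / l; set m := k' - t * k.
  have P1 := GvZ t (m *: c1).
  have uW : w' - t *: w \in W by rewrite rpredB ?rpredZ.
  have P2 := Gz (m *: c1 + t *: v) (j' - t * j) _ uW.
  apply: (mem_eql (DD _ _ P1 P2)).
  have -> : m *: c1 + t *: v + (j' - t * j) *: e + (w' - t *: w)
    = k' *: c1 + l' *: c2 + j' *: e + w'.
    have -> : l' = t * l by rewrite /t mulfVK.
    by rewrite vE zE /m; vring.
  by rewrite GZ Gc1; vring.
have GvD : G v \in D.
  have := Gt 0 1 0 0 (mem0v _).
  rewrite !scale0r scale1r add0r !addr0 Gc2 sub0r mul1r => P.
  apply: (mem_eql (DZ (- l) _ P)).
  by rewrite scalerN scaleNr opprK scalerA divff // scale1r.
move=> x; have [k' [l' [j' [w' [w'W ->]]]]] := spanc x.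
apply: (mem_eql (DD _ _ (Gt k' l' j' w' w'W) (DZ (l' / l) _ GvD))).
by rewrite subrK.
Qed.

Lemma additive_at_zero (D : pred V) (G : V -> V) v (k l j : F) w :
    zmod_closed D -> (forall m x, G (m *: x) = m *: G x) ->
    (forall x j w, w \in W -> G (x + j *: e + w) - G x \in D) ->
    G b1 = 0 -> G b2 = 0 -> (forall x, G (x + v) - G x - G v \in D) ->
    w \in W -> v = k *: b1 + l *: b2 + j *: e + w -> (k != 0) || (l != 0) ->
  forall x, G x \in D.
Proof.
move=> DB GZ Gz G1 G2 Gv wW vE /orP[k0 | l0].
  apply: (@additive_at_span D G v b2 b1 l k (j *: e + w)) => //.
  - move=> x; have [k' [l' [j' [w' [w'W ->]]]]] := spanV x.
    by exists l', k', j', w'; split=> //; vring.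
  - by rewrite vE; vring.
  by exists j, w.
apply: (@additive_at_span D G v b1 b2 k l (j *: e + w)) => //.
- by rewrite vE !addrA.
by exists j, w.
Qed.

Lemma psiDZW x j w : w \in W -> psi (x + j *: e + w) = psi x.
Proof. by move=> wW; rewrite (defectDW _ wW).1 psiDZ. Qed.

(** Otherwise [psi] would be additive at [v], and [additive_at_zero], applied to [psi x *: e] with
    the trivial subgroup, would make it vanish everywhere. *)
Lemma dpsi_neq0 v k l j w y : psi y != 0 ->
    w \in W -> v = k *: b1 + l *: b2 + j *: e + w -> (k != 0) || (l != 0) ->
  exists x, dpsi x v != 0.
Proof.
move=> y0 wW vE kl0; apply/existsP; apply: contraNT y0 => /existsPn dpsi_v0.
have e0 : e != 0 by apply: contraNneq eW => ->; apply: mem0v.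
have := @additive_at_zero (pred1 0) (fun x => psi x *: e) v k l j w.
move=> /(_ _ _ _ _ _ _ wW vE kl0 y); rewrite inE scaler_eq0 (negPf e0) orbF.
apply=> //.
- by split=> [|u t]; rewrite !inE // => /eqP-> /eqP->; rewrite subrr.
- by move=> m x; rewrite (defectZ m x).1 scalerA.
- by move=> x i u uW; rewrite psiDZW // inE subrr.
- by rewrite (defect_fix fb1).1 scale0r.
- by rewrite (defect_fix fb2).1 scale0r.
move=> x; rewrite inE -!scalerBl -/(dpsi x v).
by have := dpsi_v0 x; rewrite negbK => /eqP->; rewrite scale0r.
Qed.

(** Some element of [A] moves [v] by [i *: e] modulo [W] with [i != 0]; its power of exponent [i^-1]
    moves [v] by [e]. *)
Lemma shear_exists v k l j w y : psi y != 0 ->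
    w \in W -> v = k *: b1 + l *: b2 + j *: e + w -> (k != 0) || (l != 0) ->
  exists a c, [/\ a \in A, c \in W & a v = v + e + c].
Proof.
move=> y0 wW vE kl0; have [x d0] := dpsi_neq0 y0 wW vE kl0.
have /orbP[a aA] := defect_orbit x v.
set i := dpsi x v in d0 *; set d := phi _ - _ - _ => av.
have dW : d \in W by rewrite !rpredB.
suff pow m : exists b c, [/\ b \in A, c \in W & b v = v + (m * i) *: e + c].
  have [b [c [bA cW bv]]] := pow i^-1.
  by exists b, c; rewrite bv mulVf // scale1r.
rewrite -[m]natr_Zp; elim: (m : nat) => [|r [b [c [bA cW bv]]]].
  exists 1%g, 0; rewrite group1 mem0v perm1; split=> //.
  by rewrite mul0r scale0r !addr0.
exists (b * a)%g, (d + (r%:R * i) *: (a e - e) + c); split.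
- by rewrite groupM.
- by rewrite rpredD // rpredD // rpredZ ?Ae.
rewrite permM bv (aD _ _ aA) (aD _ _ aA) -av (AW aA cW) (aZ _ _ aA) -natr1.
by vring.
Qed.

(** As [a e - e] is in [D_v], so are the values of [kappa], and [phi] is constant along [e] modulo
    [D_v]. Then [phi x - psi x *: c] is additive at [v] modulo [D_v], hence zero modulo [D_v], and
    [f v] is up to [D_v] the image of [v] under the [psi v]-th power of the shear. *)
Lemma not_twisted_orbit v a c k l j w :
    a \in A -> c \in W -> a v = v + e + c -> a e - e \in Wstab v ->
    w \in W -> v = k *: b1 + l *: b2 + j *: e + w -> (k != 0) || (l != 0) ->
  f v \in orbit 'P A v.
Proof.
move=> aA cW av c2D wW vE kl0; set c2 := a e - e in c2D.
have kapD x : kappa x \in Wstab v.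
  apply: (mem_eql (WstabD (kappa_dpsi x aA cW av) (WstabZ (dpsi x v) c2D))).
  by rewrite subrK.
have phiDe x i : phi (x + i *: e) - phi x \in Wstab v.
  rewrite Fp_scale_mulrn; elim: (i : nat) => [|r IH].
    by apply: (mem_eql (Wstab0 v)); rewrite addr0 subrr.
  apply: (mem_eql (WstabD (kapD (x + e *+ r)) IH)).
  by rewrite /kappa mulrSr addrA; vring.
have := @additive_at_zero (Wstab v) (fun x => phi x - psi x *: c) v k l j w.
move=> /(_ _ _ _ _ _ _ wW vE kl0 v) GD.
have {GD} : phi v - psi v *: c \in Wstab v.
  apply: GD.
  - exact: Wstab_zmod.
  - by move=> m x; have [-> ->] := defectZ m x; vring.
  - move=> x i u uW; rewrite psiDZW // (defectDW _ uW).2.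
    by apply: (mem_eql (phiDe x i)); vring.
  - by have [-> ->] := defect_fix fb1; vring.
  - by have [-> ->] := defect_fix fb2; vring.
  move=> x; have P1 := Wstab_phi (x := x) aA cW av erefl.
  have P2 := WstabZ (dpsi x v * (dpsi x v - 1) / 2%:R) c2D.
  apply: (mem_eql (WstabD (WstabD P1 P2) (phiDe v (dpsi x v)))).
  have dE : psi (x + v) = dpsi x v + psi x + psi v by rewrite /dpsi; ring.
  by rewrite dE /shear_offset /c2; move: (_ / 2%:R) => b; vring.
move=> GD; have [b bA bv] := shear_pow aA av cW (psi v).
have : v + psi v *: e + shear_offset (psi v) c c2 \in orbit 'P A v.
  by rewrite -bv; apply/orbP; exists b.
move=> /orb_addWstab/(_ (WstabB GD (WstabZ (psi v * (psi v - 1) / 2%:R) c2D))) fv.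
by apply: (mem_eql fv); rewrite fE /shear_offset; move: (_ / 2%:R) => r; vring.
Qed.

(** By [kappa_dpsi] and [kappa_sub], the difference of the two sides times [a e - e] lies in [D_v],
    which does not contain [a e - e]. *)
Lemma twisted_periodic v a c x : a \in A -> c \in W -> a v = v + e + c ->
  a e - e \notin Wstab v -> dpsi (x + v) v = dpsi x v.
Proof.
move=> aA cW av; apply: contraNeq; rewrite -subr_eq0 => d0.
have P1 := kappa_dpsi (x + v) aA cW av; have P2 := kappa_dpsi x aA cW av.
have := WstabZ (dpsi (x + v) v - dpsi x v)^-1
  (WstabB (WstabB P2 P1) (WstabB (Wstab0 v) (kappa_sub x aA cW av))).
set k := dpsi (x + v) v in d0 *; set l := dpsi x v in d0 *.
move=> P; apply: (mem_eql P); rewrite -[LHS](scalerK d0); congr (_ *: _).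
by vring.
Qed.

(** By [twisted_periodic], [psi] is affine on every line parallel to [b1]; the line through [b2] and
    homogeneity reach all points with [l != 0]. *)
Lemma psi_off_twisted : twisted b1 -> forall k l, l != 0 -> psi (k *: b1 + l *: b2) = k * dpsi b2 b1.
Proof.
case=> a [aA cW nD] k l l0.
have av : a b1 = b1 + e + (a b1 - b1 - e) by vring.
have per x := twisted_periodic x aA cW av nD.
have lin x m : psi (x + m *: b1) = psi x + m * dpsi x b1.
  rewrite -[m]natr_Zp; elim: (m : nat) x => [|j IH] x.
    by rewrite scale0r addr0 mul0r addr0.
  rewrite -natr1 scalerDl scale1r [_ + b1]addrC addrA IH per /dpsi.
  by rewrite (defect_fix fb1).1; ring.
have -> : k *: b1 + l *: b2 = l *: (b2 + (k / l) *: b1).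
  by rewrite scalerDr scalerA mulrCA divff // mulr1 addrC.
rewrite (defectZ _ _).1 lin (defect_fix fb2).1 add0r mulrA.
by rewrite [l * _]mulrC divfK.
Qed.

(** For a twisted [v] with [l != 0], periodicity at [b1] equates two increments of [psi], which
    [psi_off_twisted] evaluates to 0 and [dpsi b2 b1]. So the latter is 0 and [psi] vanishes
    identically, against [psi y != 0]. *)
Lemma twisted_unique v k l j w y : psi y != 0 -> twisted b1 -> twisted v ->
  w \in W -> v = k *: b1 + l *: b2 + j *: e + w -> l = 0.
Proof.
move=> y0 tw1 [a [aA cW nD]] wW vE; apply: contraNeq y0 => l0.
have av : a v = v + e + (a v - v - e) by vring.
have psiE := psi_off_twisted tw1; set K := dpsi b2 b1 in psiE.
have vpsi m : psi (m *: b1 + v) = (m + k) * K.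
  have -> : m *: b1 + v = (m + k) *: b1 + l *: b2 + j *: e + w by rewrite vE; vring.
  by rewrite psiDZW // psiE.
have vpsi2 : psi (b1 + v + v) = (1 + k + k) * K.
  have -> : b1 + v + v = (1 + k + k) *: b1 + (l + l) *: b2 + (j + j) *: e + (w + w).
    by rewrite vE; vring.
  rewrite psiDZW ?rpredD // psiE //.
  by rewrite -mulr2n -mulr_natl mulf_neq0 ?two_neq0.
have K0 : K = 0.
  have := twisted_periodic b1 aA cW av nD; rewrite /dpsi vpsi2.
  have := vpsi 1; rewrite scale1r => ->; have := vpsi 0; rewrite scale0r add0r => ->.
  rewrite (defect_fix fb1).1 => KK; apply/eqP; rewrite eq_sym -subr_eq0; apply/eqP.
  by transitivity ((1 + k + k) * K - (1 + k) * K - (0 + k) * K -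
     ((1 + k) * K - 0 - (0 + k) * K)); [ring | rewrite KK subrr].
have [k' [l' [j' [u [uW ->]]]]] := spanV y; rewrite psiDZW //.
have [-> | l'0] := eqVneq l' 0; last by rewrite psiE // K0 mulr0.
by rewrite scale0r addr0 (defectZ _ _).1 (defect_fix fb1).1 mulr0.
Qed.

(** Here [s = 1] serves. Points of [<e> + W] are fixed, [not_twisted_orbit] settles the untwisted
    ones, and a twisted [v] lies in [<b1, e> + W], so that [psi v = 0] and [phi v] is in [D_v]. *)
Lemma defect_orbits y : psi y != 0 -> ((exists v, twisted v) -> twisted b1) ->
  forall v, f v \in orbit 'P A v.
Proof.
move=> y0 Htw v; have [k [l [j [w [wW vE]]]]] := spanV v.
have psi00 : psi 0 = 0 by have [] := @defect_fix 0 (fW (mem0v _)).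
have [kl0 | kl0] := boolP ((k != 0) || (l != 0)); last first.
  have [/eqP k0 /eqP l0] : k == 0 /\ l == 0.
    by move: kl0; rewrite negb_or !negbK => /andP[].
  suff -> : f v = v by apply: orbit_refl.
  rewrite vE k0 l0 !scale0r !add0r fE (defectDW _ wW).1 (defectDW _ wW).2.
  rewrite (defectZ _ _).1 (defectZ _ _).2 (defect_fix fe).1 (defect_fix fe).2.
  by rewrite mulr0 scale0r scaler0 !addr0.
have [a [c [aA cW av]]] := shear_exists y0 wW vE kl0.
have [c2D | nD] := boolP (a e - e \in Wstab v).
  exact: not_twisted_orbit aA cW av c2D wW vE kl0.
have bv : twisted v.
  by exists a; split=> //; rewrite av -[_ - _ - _]addrA; apply: (mem_eql cW); vring.
have l0 := twisted_unique y0 (Htw (ex_intro _ v bv)) bv wW vE.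
have vE' : v = k *: b1 + j *: e + w by rewrite vE l0 scale0r addr0.
have psiv : psi v = 0.
  by rewrite vE' psiDZW // (defectZ _ _).1 (defect_fix fb1).1 mulr0.
have phiv m : phi (v + m *: e) - phi v \in Wstab v.
  rewrite -[m]natr_Zp; elim: (m : nat) => [|r IH].
    by apply: (mem_eql (Wstab0 v)); rewrite scale0r addr0 subrr.
  apply: (mem_eql (WstabD (kappa_line r%:R aA cW av) IH)).
  by rewrite /kappa -natr1 scalerDl scale1r addrA; vring.
rewrite fE psiv scale0r addr0; apply: orb_addWstab (orbit_refl _ _ _) _.
apply: (mem_eql (WstabB (Wstab0 v) (phiv (- j)))).
have -> : v + - j *: e = k *: b1 + w by rewrite vE'; vring.
rewrite (defectDW _ wW).2 (defectZ _ _).2 (defect_fix fb1).2.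
by vring.
Qed.

End Defect.

End NormalizedIso.

(** * Coordinates in dimension five and the case [psi = 0] *)

Lemma coord_free5 p (b1 b2 e w1 w2 : 'rV['F_p]_5) : free [:: b1; b2; e; w1; w2] ->
  exists c0 c1 c2 c3 c4 : 'rV['F_p]_5 -> 'F_p,
  [/\ [/\ linear_form c0, linear_form c1, linear_form c2, linear_form c3 & linear_form c4],
      forall x, x = c0 x *: b1 + c1 x *: b2 + c2 x *: e + (c3 x *: w1 + c4 x *: w2) &
      forall k0 k1 k2 k3 k4,
        let x := k0 *: b1 + k1 *: b2 + k2 *: e + (k3 *: w1 + k4 *: w2) in
        [/\ c0 x = k0, c1 x = k1, c2 x = k2, c3 x = k3 & c4 x = k4]].
Proof.
pose X := [tuple b1; b2; e; w1; w2] => Xf.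
have Xb : basis_of fullv X by rewrite basisEfree Xf subvf dimvf /dim /= mul1n.
pose i0 : 'I_5 := ord0; pose i1 : 'I_5 := lift ord0 ord0.
pose i2 : 'I_5 := lift ord0 (lift ord0 ord0).
pose i3 : 'I_5 := lift ord0 (lift ord0 (lift ord0 ord0)).
pose i4 : 'I_5 := lift ord0 (lift ord0 (lift ord0 (lift ord0 ord0))).
have cL i : linear_form (coord X i) by move=> k x y; rewrite linearP.
exists (coord X i0), (coord X i1), (coord X i2), (coord X i3), (coord X i4).
split=> // [x | k0 k1 k2 k3 k4 x].
  rewrite [LHS](coord_basis Xb (memvf x)) !big_ord_recl big_ord0 addr0 !addrA.
  by [].
have X0 j : coord X j b1 = (i0 == j)%:R := coord_free i0 j Xf.
have X1 j : coord X j b2 = (i1 == j)%:R := coord_free i1 j Xf.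
have X2 j : coord X j e = (i2 == j)%:R := coord_free i2 j Xf.
have X3 j : coord X j w1 = (i3 == j)%:R := coord_free i3 j Xf.
have X4 j : coord X j w2 = (i4 == j)%:R := coord_free i4 j Xf.
have cE j : coord X j x = k0 * (i0 == j)%:R + k1 * (i1 == j)%:R
    + k2 * (i2 == j)%:R + (k3 * (i3 == j)%:R + k4 * (i4 == j)%:R).
  by rewrite /x !linearD !linearZ /= X0 X1 X2 X3 X4.
by split; rewrite cE /= ?mulr1 ?mulr0 ?addr0 ?add0r.
Qed.

(** If [D] has a nonzero element [d0], the form is the determinant against [d0]: were it nonzero at
    some [u] in [D], Cramer's rule would put [d] in [D]. If [D] is zero, a coordinate that is
    nonzero at [d] serves. *)
Lemma separate_plane p n (D : pred 'rV['F_p]_n) (d w1 w2 : 'rV['F_p]_n)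
    (x1 x2 : 'rV['F_p]_n -> 'F_p) :
    linear_form x1 -> linear_form x2 ->
    (forall k u v, u \in D -> v \in D -> k *: u + v \in D) ->
    (forall u, u \in D -> u = x1 u *: w1 + x2 u *: w2) -> d = x1 d *: w1 + x2 d *: w2 ->
    0 \in D -> d \notin D ->
  exists l m, (forall u, u \in D -> l * x1 u + m * x2 u = 0) /\ l * x1 d + m * x2 d != 0.
Proof.
move=> x1L x2L DL DE dE D0 dD.
have x10 : x1 0 = 0 by rewrite -(scale0r 0) linear_formZ // mul0r.
have x20 : x2 0 = 0 by rewrite -(scale0r 0) linear_formZ // mul0r.
have DZ k u : u \in D -> k *: u \in D by move=> uD; rewrite -[k *: u]addr0 DL.
have [/existsP[d0 /andP[d0D d00]] | /existsPn nD] :=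
  boolP [exists d0, (d0 \in D) && (d0 != 0)].
  exists (- x2 d0), (x1 d0); split=> [u uD|].
    apply/eqP; apply: contraNT dD; set c := - x2 d0 * x1 u + x1 d0 * x2 u => c0.
    have -> : d = ((x1 d * x2 u - x2 d * x1 u) / c) *: d0 +
                  ((x1 d0 * x2 d - x2 d0 * x1 d) / c) *: u.
      have ew a1 a2 u1 u2 e1 e2 : - a2 * u1 + a1 * u2 != 0 -> e1 *: w1 + e2 *: w2 =
          ((e1 * u2 - e2 * u1) / (- a2 * u1 + a1 * u2)) *: (a1 *: w1 + a2 *: w2) +
          ((a1 * e2 - a2 * e1) / (- a2 * u1 + a1 * u2)) *: (u1 *: w1 + u2 *: w2).
        by move=> dt0; apply/rowP=> i; rewrite !mxE; field.
      by have := ew _ _ _ _ (x1 d) (x2 d) c0; rewrite -dE -!DE.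
    by apply: DL => //; apply: DZ.
  apply: contraNneq dD => dt0.
  have [x1d0 | x1d0] := eqVneq (x1 d0) 0.
    have x2d0 : x2 d0 != 0.
      by apply: contraNneq d00 => x2d0; rewrite (DE d0) // x1d0 x2d0 !scale0r addr0.
    have -> : d = (x2 d / x2 d0) *: d0; last exact: DZ.
    rewrite x1d0 mul0r addr0 in dt0; move/eqP: dt0.
    rewrite mulf_eq0 oppr_eq0 (negPf x2d0) /= => /eqP x1d.
    have d0E : d0 = x2 d0 *: w2 by rewrite [LHS](DE d0) // x1d0 scale0r add0r.
    transitivity ((x2 d / x2 d0) *: (x2 d0 *: w2)); last by rewrite -d0E.
    by rewrite scalerA divfK // [LHS]dE x1d scale0r add0r.
  have -> : d = (x1 d / x1 d0) *: d0; last exact: DZ.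
  have x2d : x2 d = x1 d / x1 d0 * x2 d0.
    apply: (mulfI x1d0); rewrite mulrA mulrCA divff // mulr1.
    by move/eqP: dt0; rewrite mulNr addrC subr_eq0 => /eqP->; rewrite mulrC.
  transitivity ((x1 d / x1 d0) *: (x1 d0 *: w1 + x2 d0 *: w2)); last by rewrite -DE.
  by rewrite scalerDr !scalerA divfK // -x2d -dE.
have Du u : u \in D -> u = 0 by move=> uD; apply/eqP; have := nD u; rewrite uD negbK.
have d0 : d != 0 by apply: contraNneq dD => ->.
have [x1d | x1d] := eqVneq (x1 d) 0.
  exists 0, 1; split=> [u /Du-> | ]; first by rewrite x10 x20 !mulr0 addr0.
  rewrite mul0r mul1r add0r; apply: contraNneq d0 => x2d.
  by rewrite dE x1d x2d !scale0r addr0.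
exists 1, 0; split=> [u /Du-> | ]; first by rewrite x10 x20 !mulr0 addr0.
by rewrite mul0r mul1r addr0.
Qed.

(** [phi] factors through the quotient by [W], of dimension 3, and its coordinates span a pencil. A
    form that kills [D_v] gives a member additive at [v], which there agrees with the linear [t]
    from [common_linearization]; by [separate_plane], [phi v - t v] is in [D_v]. *)
Lemma linear_defect_orbits p (A : {group {perm 'rV['F_p]_5}}) (b1 b2 e w1 w2 : 'rV['F_p]_5)
    (phi : 'rV['F_p]_5 -> 'rV['F_p]_5) :
    let W := <<[:: w1; w2]>>%VS in
    A \subset autH _ -> free [:: b1; b2; e; w1; w2] ->
    (forall a w, a \in A -> w \in W -> a w = w) ->
    (forall x, phi x \in W) -> (forall k x, phi (k *: x) = k *: phi x) ->
    (forall x w, w \in W -> phi (x + w) = phi x) ->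
    (forall x v, phi (x + v) - phi x - phi v \in Wstab A W v) ->
  exists2 s : 'rV['F_p]_5 -> 'rV['F_p]_5, {morph s : x y / x + y} &
    forall v, exists2 a, a \in A & v + phi v = s (a v).
Proof.
move=> W sAH Xf AW phiW phiZ phiDW phiD.
have [c0 [c1 [c2 [c3 [c4 [[c0L c1L c2L c3L c4L] cE cX]]]]]] := coord_free5 Xf.
(* [C] is the quotient map by [W], and [E] is a linear section of it. *)
pose E (u : 'rV['F_p]_3) : 'rV['F_p]_5 := u 0 0 *: b1 + u 0 1 *: b2 + u 0 2%:R *: e.
pose C x : 'rV['F_p]_3 := c0 x *: delta_mx 0 0 + c1 x *: delta_mx 0 1 + c2 x *: delta_mx 0 2%:R.
have WE w : w \in W -> w = c3 w *: w1 + c4 w *: w2 /\ [/\ c0 w = 0, c1 w = 0 & c2 w = 0].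
  move=> wW; have [k3 [k4 ->]] : exists k3 k4, w = k3 *: w1 + k4 *: w2.
    rewrite (@coord_span _ _ _ [tuple w1; w2] _ wW).
    by rewrite !big_ord_recl big_ord0 addr0; do 2!eexists.
  have := cX 0 0 0 k3 k4; rewrite /= !scale0r !add0r.
  by case=> -> -> -> -> ->.
have EC x : exists2 w, w \in W & E (C x) = x + w.
  exists (- (c3 x *: w1 + c4 x *: w2)).
    by rewrite rpredN rpredD ?rpredZ ?memv_span ?mem_seq2 ?eqxx ?orbT.
  rewrite [X in _ = X - _](cE x) addrK /E /C !mxE /= !mulr1 !mulr0 !addr0 !add0r.
  by [].
have phiEC u x : phi (E u + E (C x)) = phi (E u + x).
  by have [w wW ->] := EC x; rewrite addrA phiDW.
have EZ k u : E (k *: u) = k *: E u by rewrite /E !mxE; vring.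
have ED u t : E (u + t) = E u + E t by rewrite /E !mxE; vring.
have h3 : homogeneous (fun u => c3 (phi (E u))).
  by move=> k u; rewrite EZ phiZ linear_formZ.
have h4 : homogeneous (fun u => c4 (phi (E u))).
  by move=> k u; rewrite EZ phiZ linear_formZ.
have [s1 [s2 [s1L s2L sP]]] := common_linearization h3 h4.
pose t x := s1 (C x) *: w1 + s2 (C x) *: w2.
have tW x : t x \in W.
  by rewrite rpredD ?rpredZ ?memv_span ?mem_seq2 ?eqxx ?orbT.
have CD : {morph C : x y / x + y}.
  by move=> x y; rewrite /C !linear_formD //; vring.
have tD : {morph t : x y / x + y}.
  by move=> x y; rewrite /t CD !linear_formD //; vring.
have CW w : w \in W -> C w = 0.
  by case/WE=> _ [w0 w1' w2']; rewrite /C w0 w1' w2' !scale0r !addr0.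
exists (fun x => x + t x) => [x y | v]; first by rewrite tD; vring.
have dW : phi v - t v \in W by rewrite rpredB.
suff /WstabP[_ [a aA av]] : phi v - t v \in Wstab A W v.
  exists a => //; rewrite av tD [t (phi v - _)]/t CW //.
  have s0 (g : 'rV['F_p]_3 -> 'F_p) : linear_form g -> g 0 = 0.
    by move=> gL; rewrite -(scale0r 0) linear_formZ // mul0r.
  by rewrite !s0 // !scale0r !addr0; vring.
apply: contraT => dD.
have [l [m [lmD /negP[]]]] := separate_plane c3L c4L
  (fun k u u' uD u'D => WstabD sAH AW (WstabZ sAH AW k uD) u'D)
  (fun u uD => proj1 (WE u (proj1 (WstabP _ _ _ _ uD)))) (proj1 (WE _ dW))
  (Wstab0 sAH AW v) dD.
have lD u u' : l * c3 (u + u') + m * c4 (u + u') =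
  (l * c3 u + m * c4 u) + (l * c3 u' + m * c4 u') by rewrite !linear_formD //; ring.
have phiCv : phi (E (C v)) = phi v.
  by have [w wW ->] := EC v; rewrite phiDW.
have : additive_at (pencil (fun u => c3 (phi (E u))) (fun u => c4 (phi (E u))) l m) (C v).
  apply/additive_atP=> u; rewrite /pencil ED phiEC phiCv -lD.
  have -> : phi (E u + v) = phi (E u + v) - phi (E u) - phi v + (phi (E u) + phi v) by vring.
  by rewrite lD lmD ?add0r // phiD.
move/sP; rewrite /pencil phiCv => sE.
have c3t : c3 (t v) = s1 (C v).
  by have := cX 0 0 0 (s1 (C v)) (s2 (C v)); rewrite /= !scale0r !add0r; case.
have c4t : c4 (t v) = s2 (C v).
  by have := cX 0 0 0 (s1 (C v)) (s2 (C v)); rewrite /= !scale0r !add0r; case.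
have := lD (phi v - t v) (t v); rewrite subrK c3t c4t sE => /eqP.
by rewrite -subr_eq subrr eq_sym.
Qed.

(** * Existence of a linear map *)

Section Linearization.
Variables (p : nat) (A : {group {perm 'rV['F_p]_5}}).
Hypotheses (p_pr : prime p) (p_odd : odd p).
Hypotheses (sAH : A \subset autH _) (pA : (p.-group A)%g).
Local Notation F := 'F_p.
Local Notation V := 'rV[F]_5.
Implicit Types (f s : V -> V) (a : {perm V}) (x v w : V) (k : F).

Definition orbit_additive f := forall x v, exists2 a, a \in A & f (x + v) = f x + f (a v).
Definition scalar_equivariant f := forall k x, f (k *: x) = k *: f x.
Definition linearizable f := exists2 s, {morph s : x y / x + y} &
  forall v, exists2 a, a \in A & f v = s (a v).

Let aD a x v : a \in A -> a (x + v) = a x + a v.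
Proof. by move=> aA; apply/autHP/(subsetP sAH). Qed.

Let aZ a k v : a \in A -> a (k *: v) = k *: a v.
Proof. by move=> aA; apply: autHZ => //; apply: (subsetP sAH). Qed.

Lemma additive_scale s k x : {morph s : x y / x + y} -> s (k *: x) = k *: s x.
Proof.
move=> sD; have s0 : s 0 = 0 by apply: (addrI (s 0)); rewrite -sD !addr0.
rewrite !Fp_scale_mulrn; elim: (k : nat) => // j IH.
by rewrite !mulrS sD IH.
Qed.

(** In the last term of the chain not contained in [S], any vector outside [S] serves: [A] moves it
    by elements of the next term. *)
Lemma fixed_mod_subspace (S : {vspace V}) : S != fullv ->
  exists2 e, e \notin S & forall a, a \in A -> a e - e \in S.
Proof.
move=> SV; have pH := elementary_pnat_card p_pr (@Fp_mulrn p 5 p_pr).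
have [L [L0 _ LS] [m Lm]] := unipotent_chain sAH pH pA.
pose P i := [forall v, L i v ==> (v \in S)].
have exP : exists i, P i.
  by exists m; apply/forall_inP=> v /Lm->; apply: mem0v.
have [[|i] Pi min_i] := ex_minnP exP.
  case/eqP: SV; apply/vspaceP=> v; rewrite memvf.
  by have /forallP/(_ v) := Pi; rewrite L0.
have : ~~ P i by apply/negP=> /min_i; rewrite ltnn.
rewrite negb_forall => /existsP[e]; rewrite negb_imply => /andP[Le eS].
by exists e => // a aA; have /forall_inP := Pi; apply; apply: LS.
Qed.

Section Basis.
Variables (e w1 w2 : V).
Let W := <<[:: w1; w2]>>%VS.
Let Z := <<[:: e; w1; w2]>>%VS.
Hypothesis (Zfree : free [:: e; w1; w2]).
Hypothesis (AW : forall a w, a \in A -> w \in W -> a w = w).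
Hypothesis (Ae : forall a, a \in A -> a e - e \in W).

Let eW : e \notin W.
Proof. by have := Zfree; rewrite free_cons => /andP[]. Qed.

Lemma mem_Z z : z \in Z -> exists j w, w \in W /\ z = j *: e + w.
Proof.
move=> zZ; rewrite (@coord_span _ _ _ [tuple e; w1; w2] _ zZ).
rewrite big_ord_recl; do 2!eexists; split; last by [].
apply: rpred_sum => i _; apply: rpredZ; apply: memv_span.
exact: (@mem_nth _ 0 [:: w1; w2] i (ltn_ord i)).
Qed.

Lemma orbit_additive_W f w : orbit_additive f -> w \in W -> forall x, f (x + w) = f x + f w.
Proof. by move=> fA wW x; have [a aA ->] := fA x w; rewrite (AW aA). Qed.

Lemma normalized_linearizable f b1 b2 :
    orbit_additive f -> scalar_equivariant f -> free [:: b1; b2; e; w1; w2] ->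
    (forall v, f v - v \in Z) ->
    [/\ f b1 = b1, f b2 = b2, f e = e, f w1 = w1 & f w2 = w2] ->
    ((exists v, twisted A W e v) -> twisted A W e b1) ->
  linearizable f.
Proof.
move=> fA fZ Xf fZZ [fb1 fb2 fe fw1 fw2] Htw.
have [c0 [c1 [c2 [c3 [c4 [[c0L c1L c2L c3L c4L] cE cX]]]]]] := coord_free5 Xf.
have fW w : w \in W -> f w = w.
  move=> wW; have [k [l ->]] := span2P wW.
  rewrite orbit_additive_W // ?fZ ?fw1 ?fw2 //.
  by rewrite rpredZ // memv_span // mem_seq2 eqxx orbT.
pose psi x := c2 (f x - x); pose phi x := c3 (f x - x) *: w1 + c4 (f x - x) *: w2.
have phiW x : phi x \in W.
  by rewrite rpredD // rpredZ // memv_span // mem_seq2 eqxx ?orbT.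
have fE x : f x = x + psi x *: e + phi x.
  rewrite -[LHS](subrK x) addrC -addrA; congr (_ + _).
  have [j [w [wW zE]]] := mem_Z (fZZ x).
  rewrite /phi /psi; move: (f x - x) zE => z zE.
  suff [z0 z1] : c0 z = 0 /\ c1 z = 0.
    by rewrite {1}[z]cE z0 z1 !scale0r !add0r.
  have [k [l wE]] := span2P wW.
  have := cX 0 0 j k l; rewrite /= !scale0r !add0r -wE -zE.
  by case.
have spanV v : exists k l j w, w \in W /\ v = k *: b1 + l *: b2 + j *: e + w.
  exists (c0 v), (c1 v), (c2 v), (c3 v *: w1 + c4 v *: w2); split; last exact: cE.
  by rewrite rpredD // rpredZ // memv_span // mem_seq2 eqxx ?orbT.
have [/existsP[y y0] | /existsPn psi0] := boolP [exists y, psi y != 0].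
  exists id => // v.
  have := defect_orbits p_pr p_odd sAH eW AW Ae fA fZ fE phiW fe fW fb1 fb2 spanV y0 Htw v.
  by case/orbP=> a aA ->; exists a.
have {}psi0 x : psi x = 0 by apply/eqP; have := psi0 x; rewrite negbK.
have phiZ k x : phi (k *: x) = k *: phi x by have [] := defectZ eW fZ fE phiW k x.
have phiDW x w : w \in W -> phi (x + w) = phi x.
  by move=> wW; have [] := defectDW eW AW fA fE phiW fW x wW.
have phiD x v : phi (x + v) - phi x - phi v \in Wstab A W v.
  rewrite inE; apply/andP; split; first by rewrite !rpredB.
  have := defect_orbit eW AW Ae fA fE phiW fe fW x v.
  by rewrite /dpsi !psi0 !subr0 scale0r addr0.
have [s sD sP] := linear_defect_orbits sAH Xf AW phiW phiZ phiDW phiD.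
by exists s => // v; rewrite fE psi0 scale0r addr0.
Qed.

(** [A] moves vectors of [Z] only by elements of [W], so it cannot add [e]. *)
Lemma twisted_notin v : twisted A W e v -> v \notin Z.
Proof.
case=> a [aA cW _]; apply: contra eW => /mem_Z[j [w [wW vE]]].
have -> : e = j *: (a e - e) - (a v - v - e).
  by rewrite vE (aD _ _ aA) (aZ _ _ aA) (AW aA wW); vring.
by rewrite rpredB // rpredZ // Ae.
Qed.

Lemma unipotent_linearizable f :
    orbit_additive f -> scalar_equivariant f ->
    (forall v, f v - v \in Z) -> f e = e -> f w1 = w1 -> f w2 = w2 ->
  linearizable f.
Proof.
move=> fA fZ fZZ fe fw1 fw2.
pose twistedb v := [exists a, [&& a \in A, a v - v - e \in W & a e - e \notin Wstab A W v]].
have twistedP v : reflect (twisted A W e v) (twistedb v).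
  by apply: (iffP existsP) => -[a]; [case/and3P | case]; exists a => //; apply/and3P.
(* A twisted vector is taken as [b1] if there is one. *)
have [b1 b1Z b1tw] : exists2 b1, b1 \notin Z & (exists v, twisted A W e v) -> twisted A W e b1.
  have [/existsP[b1 /twistedP tb1'] | /existsPn ntw] := boolP [exists v, twistedb v].
    by exists b1; first exact: twisted_notin.
  have [b1 b1Z _] := fixed_mod_subspace (@span_neq_full _ 5 [:: e; w1; w2] isT).
  by exists b1 => // -[v /twistedP]; rewrite (negPf (ntw v)).
have [b2 b2Z _] := fixed_mod_subspace (@span_neq_full _ 5 [:: b1; e; w1; w2] isT).
have Xf : free [:: b1; b2; e; w1; w2].
  rewrite (perm_free (Y := [:: b2; b1; e; w1; w2])).
    by rewrite free_cons b2Z free_cons b1Z Zfree.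
  by rewrite -[[:: b1, b2 & _]]/([:: b1] ++ [:: b2] ++ [:: e; w1; w2]) perm_catCA.
have [c0 [c1 [c2 [c3 [c4 [[c0L c1L c2L c3L c4L] cE cX]]]]]] := coord_free5 Xf.
have cZ z : z \in Z -> c0 z = 0 /\ c1 z = 0.
  case/mem_Z=> j [w [wW ->]]; have [k [l ->]] := span2P wW.
  by have := cX 0 0 j k l; rewrite /= !scale0r !add0r; case.
(* [t] maps into [Z], kills [Z] and agrees with [f - 1] at [b1] and [b2]; subtracting it yields a
   map that fixes the whole basis. *)
pose t x := c0 x *: (f b1 - b1) + c1 x *: (f b2 - b2).
have tZ x : t x \in Z by rewrite rpredD ?rpredZ.
have tD : {morph t : x y / x + y} by move=> x y; rewrite /t !linear_formD //; vring.
have t_Z z : z \in Z -> t z = 0.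
  by case/cZ=> z0 z1; rewrite /t z0 z1 !scale0r addr0.
have t_mod x y : x - y \in Z -> t x = t y.
  by move=> xyZ; rewrite -[x](subrK y) tD t_Z ?add0r.
have tf x : t (f x) = t x by apply: t_mod.
have [eZ w1Z w2Z] : [/\ e \in Z, w1 \in Z & w2 \in Z].
  by split; rewrite memv_span // !inE eqxx ?orbT.
have tb1 : t b1 = f b1 - b1.
  have := cX 1 0 0 0 0; rewrite /= !scale0r !addr0 scale1r => -[b10 b11 _ _ _].
  by rewrite /t b10 b11 scale0r addr0 scale1r.
have tb2 : t b2 = f b2 - b2.
  have := cX 0 1 0 0 0; rewrite /= !scale0r !addr0 add0r scale1r => -[b20 b21 _ _ _].
  by rewrite /t b20 b21 scale0r add0r scale1r.
pose g x := f x - t x.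
have [s sD sP] : linearizable g.
  apply: (@normalized_linearizable g b1 b2) => //.
  - move=> x v; have [a aA fxv] := fA x v; exists a => //.
    rewrite /g fxv tD -[t (a v)]tf.
    suff -> : t (f (a v)) = t v by vring.
    apply: (addrI (t (f x))); rewrite -tD -fxv !tf tD; by [].
  - by move=> k x; rewrite /g fZ (additive_scale _ _ tD) scalerBr.
  - by move=> v; rewrite /g addrAC rpredB.
  by rewrite /g tb1 tb2 !t_Z // fe fw1 fw2 !subr0; split=> //; vring.
(* [t] takes the same value at [v] and [g v], so [a v] is sent to [g v + t v = f v]. *)
exists (fun x => s x + t (s x)) => [x y | v]; first by rewrite sD tD; vring.
have [a aA gv] := sP v; exists a => //; rewrite -gv.
have -> : t (g v) = t v by rewrite -[RHS]tf; apply: t_mod; rewrite /g addrAC subrr sub0r rpredN.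
by rewrite /g subrK.
Qed.

End Basis.
End Linearization.

Lemma additive_surj_inverse (H : finZmodType) (s : H -> H) :
    {morph s : x y / x + y} -> (forall y, exists x, y = s x) ->
  exists2 t : H -> H, {morph t : x y / x + y} & cancel s t /\ cancel t s.
Proof.
move=> sD s_onto; pose t y := if [pick x | y == s x] is Some x then x else 0.
have tK : cancel t s.
  move=> y; rewrite /t; case: pickP => [x /eqP-> // | no].
  by have [x yx] := s_onto y; have := no x; rewrite -yx eqxx.
have [u tu ut] := injF_bij (can_inj tK).
have sK : cancel s t by move=> x; rewrite -[x]ut tK.
by exists t => // x y; apply: (can_inj sK); rewrite sD !tK.
Qed.

Section MainLinearization.
Variables (p : nat) (A : {group {perm 'rV['F_p]_5}}).
Hypotheses (p_pr : prime p) (p_odd : odd p).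
Hypotheses (sAH : A \subset autH _) (pA : (p.-group A)%g).
Local Notation F := 'F_p.
Local Notation V := 'rV[F]_5.

(** Let [s] be linear and agree with [f] on a basis in which [A] fixes [e] modulo [W] and [y] modulo
    [Z = <e> + W]. With homogeneity along [x0], [f - s] has values in [D = s(Z)]; as [f] is onto,
    [s] is invertible, and [f] followed by its inverse is the identity modulo [Z]. *)
Lemma orbit_additive_linearizable (f : V -> V) (w1 w2 : V) :
    free [:: w1; w2] -> (forall a w, a \in A -> w \in <<[:: w1; w2]>>%VS -> a w = w) ->
    orbit_additive A f -> scalar_equivariant f -> (forall y, exists x, y = f x) ->
  linearizable A f.
Proof.
move=> Wf AW fA fZ f_onto; set W := <<_>>%VS in AW.
have flag := fixed_mod_subspace p_pr sAH pA.
have [e eW Ae] := flag _ (@span_neq_full _ 5 [:: w1; w2] isT).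
have Zf : free [:: e; w1; w2] by rewrite free_cons eW.
have [y yZ Ay] := flag _ (@span_neq_full _ 5 [:: e; w1; w2] isT).
have [x0 x0Y _] := flag _ (@span_neq_full _ 5 [:: y; e; w1; w2] isT).
have Xf : free [:: x0; y; e; w1; w2] by rewrite free_cons x0Y free_cons yZ Zf.
have [c0 [c1 [c2 [c3 [c4 [[c0L c1L c2L c3L c4L] cE cX]]]]]] := coord_free5 Xf.
pose s x := c0 x *: f x0 + c1 x *: f y + c2 x *: f e + (c3 x *: f w1 + c4 x *: f w2).
have sD : {morph s : x z / x + z} by move=> x z; rewrite /s !linear_formD //; vring.
pose D := [pred d | [exists j, [exists k, [exists l,
  d == j *: f e + (k *: f w1 + l *: f w2)]]]].
have DP d : reflect (exists j k l, d = j *: f e + (k *: f w1 + l *: f w2)) (d \in D).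
  apply: (iffP existsP) => -[j].
    by case/existsP=> k /existsP[l /eqP->]; exists j, k, l.
  by move=> [k [l ->]]; exists j; apply/existsP; exists k; apply/existsP; exists l.
have DD d d' : d \in D -> d' \in D -> d + d' \in D.
  case/DP=> [j [k [l ->]]] /DP[j' [k' [l' ->]]]; apply/DP.
  by exists (j + j'), (k + k'), (l + l'); vring.
have D0 : 0 \in D by apply/DP; exists 0, 0, 0; vring.
have fDW := orbit_additive_W AW fA.
have fW w : w \in W -> f w \in D.
  move=> wW; have [k [l ->]] := span2P wW.
  rewrite fDW ?rpredZ ?memv_span ?mem_seq2 ?eqxx ?orbT // !fZ.
  by apply/DP; exists 0, k, l; vring.
have feD j x : f (x + j *: e) - f x \in D.
  rewrite Fp_scale_mulrn; elim: (j : nat) => [|i IH].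
    by apply: (mem_eql D0); rewrite addr0 subrr.
  have [a aA fxe] := fA (x + e *+ i) e.
  have De : f (a e) \in D.
    have -> : a e = e + (a e - e) by vring.
    rewrite (fDW _ (Ae a aA)); apply: DD; last exact: fW (Ae a aA).
    by apply/DP; exists 1, 0, 0; vring.
  apply: (mem_eql (DD _ _ IH De)).
  by rewrite mulrSr addrA fxe; vring.
have fZD z x : z \in <<[:: e; w1; w2]>>%VS -> f (x + z) - f x \in D.
  case/mem_Z=> j [w [wW ->]]; rewrite addrA fDW //.
  by apply: (mem_eql (DD _ _ (feD j x) (fW w wW))); vring.
have fyD k x : f (x + k *: y) - f x - k *: f y \in D.
  rewrite !Fp_scale_mulrn; elim: (k : nat) => [|i IH].
    by apply: (mem_eql D0); rewrite !mulr0n addr0; vring.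
  have [a aA fxy] := fA (x + y *+ i) y.
  have := fZD _ y (Ay a aA); rewrite [y + _]addrC subrK => P.
  apply: (mem_eql (DD _ _ IH P)).
  by rewrite !mulrSr addrA fxy; vring.
have sDZ d : d \in D -> exists2 z, z \in <<[:: e; w1; w2]>>%VS & s z = d.
  case/DP=> [j [k [l ->]]]; exists (j *: e + (k *: w1 + l *: w2)).
    by rewrite !rpredD // rpredZ // memv_span // !inE eqxx ?orbT.
  have := cX 0 0 j k l; rewrite /= !scale0r !add0r => -[wc0 wc1 wc2 wc3 wc4].
  by rewrite /s wc0 wc1 wc2 wc3 wc4; vring.
have fsD v : f v - s v \in D.
  set z := c2 v *: e + (c3 v *: w1 + c4 v *: w2).
  have zZ : z \in <<[:: e; w1; w2]>>%VS.
    by rewrite !rpredD // rpredZ // memv_span // !inE eqxx ?orbT.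
  have P1 := fZD z (c0 v *: x0 + c1 v *: y) zZ.
  have P2 := fyD (c1 v) (c0 v *: x0); rewrite fZ in P2.
  have P3 : - (c2 v *: f e + (c3 v *: f w1 + c4 v *: f w2)) \in D.
    by apply/DP; exists (- c2 v), (- c3 v), (- c4 v); vring.
  apply: (mem_eql (DD _ _ (DD _ _ P1 P2) P3)).
  have <- : v = c0 v *: x0 + c1 v *: y + z by rewrite addrA; apply: cE.
  by rewrite /s; vring.
have s_onto v : exists x, v = s x.
  have [u ->] := f_onto v; have [z _ sz] := sDZ _ (fsD u).
  by exists (u + z); rewrite sD sz; vring.
have [t tD [sK tK]] := additive_surj_inverse sD s_onto.
have sval u : f u = s u -> t (f u) = u by move=> ->; rewrite sK.
have [r rD rP] : linearizable A (fun x => t (f x)).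
  apply: (unipotent_linearizable p_pr p_odd sAH pA Zf AW Ae).
  - by move=> x v; have [a aA fxv] := fA x v; exists a => //; rewrite fxv tD.
  - by move=> k x; rewrite fZ (additive_scale _ _ tD).
  - move=> v; have [z zZ sz] := sDZ _ (fsD v).
    by rewrite -(subrK (s v) (f v)) -sz tD !sK addrK.
  - have := cX 0 0 1 0 0; rewrite /= !scale0r !add0r !addr0 scale1r => -[h0 h1 h2 h3 h4].
    by apply: sval; rewrite /s h0 h1 h2 h3 h4; vring.
  - have := cX 0 0 0 1 0; rewrite /= !scale0r !add0r !addr0 scale1r => -[h0 h1 h2 h3 h4].
    by apply: sval; rewrite /s h0 h1 h2 h3 h4; vring.
  have := cX 0 0 0 0 1; rewrite /= !scale0r !add0r scale1r => -[h0 h1 h2 h3 h4].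
  by apply: sval; rewrite /s h0 h1 h2 h3 h4; vring.
exists (fun x => s (r x)) => [x z | v]; first by rewrite rD sD.
by have [a aA tv] := rP v; exists a; rewrite // -tv tK.
Qed.

(** A translation that commutes with [a] is by a vector fixed by [a], and [p ^ 2] fixed vectors do
    not fit in a line. *)
Lemma two_fixed_vectors : (p ^ 2 <= #|CHR A|)%N ->
  exists w1 w2 : V, free [:: w1; w2] /\
    forall a w, a \in A -> w \in <<[:: w1; w2]>>%VS -> a w = w.
Proof.
move=> leA; pose Fix := [set h : V | [forall a in A, a h == h]].
have sCF : CHR A \subset @transl V @: Fix.
  apply/subsetP=> _ /setIP[/imsetP[h _ ->] /centP cA]; apply: imset_f.
  rewrite inE; apply/forall_inP=> a aA; apply/eqP/(@transl_inj V).
  rewrite -translJ ?(subsetP sAH) //.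
  by rewrite /conjg (cA a aA) mulKg.
have leF : (p ^ 2 <= #|Fix|)%N.
  by apply: leq_trans leA (leq_trans (subset_leq_card sCF) (leq_imset_card _ _)).
have ex w : exists2 w', w' \in Fix & forall k : F, w' != k *: w.
  have : ~~ (Fix \subset [set k *: w | k : F]).
    apply: contraL leF => /subset_leq_card leFp; rewrite -ltnNge.
    apply: leq_ltn_trans (leq_trans leFp (leq_imset_card _ _)) _.
    by rewrite card_Fp // -[X in (X < _)%N]expn1 ltn_exp2l // prime_gt1.
  case/subsetPn=> w' w'F w'k; exists w' => // k.
  by apply: contraNneq w'k => ->; apply: imset_f.
have [w1 w1F w10] := ex 0; have [w2 w2F w21] := ex w1.
have w1n0 : w1 != 0 by have := w10 0; rewrite scaler0.
exists w2, w1; split.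
  rewrite free_cons span_seq1 seq1_free w1n0 andbT.
  by apply/vlineP=> -[k wk]; have := w21 k; rewrite wk eqxx.
move=> a w aA wW; have [k [l ->]] := span2P wW.
have fixE h : h \in Fix -> a h = h.
  by rewrite inE => /forall_inP/(_ a aA)/eqP.
have aH := subsetP sAH a aA.
by rewrite (autHP _ aH) !autHZ // !fixE.
Qed.

End MainLinearization.

Local Close Scope ring_scope.

Theorem theorem3p5 (p : nat) (A : {group {perm 'rV['F_p]_5}}) :
  prime p -> odd p ->
  A \subset autH _ ->
  (p.-group A)%g ->
  p ^ 2 <= #|CHR A| ->
  CI_Sring (VHA A).
Proof.
move=> p_pr p_odd sAH pA leA; apply/eqP; rewrite eqEsubset.
rewrite (mulAutS_sub_IsoS sAH) andbT; apply/subsetP=> f fI.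
(* A translation after [f] makes it fix 0. *)
have f0A := IsoS_orbit_iso fI; set f0 := (f * _)%g in f0A.
have [g gS gZ] := homogenize p_pr sAH pA f0A.
have [w1 [w2 [Wf AW]]] := two_fixed_vectors p_pr sAH leA.
have gfA := orbit_iso_mull gS f0A; set fg := (g * f0)%g in gZ gfA.
have [s sD sP] := orbit_additive_linearizable p_pr p_odd sAH pA Wf AW (proj2 gfA) gZ
  (fun y => ex_intro _ (fg^-1%g y) (esym (permKV fg y))).
have s_onto y : exists x, y = s x.
  by have [a _ e] := sP (fg^-1%g y); exists (a (fg^-1%g y)); rewrite -e permKV.
have [t _ [sK _]] := additive_surj_inverse sD s_onto.
pose sg := perm (can_inj sK).
apply: (@linear_mulAutS _ A f sg) => //.
  by apply/autHP=> x y; rewrite !permE.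
(* [f0 v] is [fg] at [g^-1 v], a point in the orbit of [v]; so the linear map found for [fg] also
   serves for [f0]. *)
move=> v; have gVS : g^-1%g \in orbital_stab_group A by rewrite groupV.
have [b bA gv] := orbital_stab_orb v gVS.
have [a aA fv] := sP (g^-1%g v).
exists (b * a)%g; first by rewrite groupM.
by rewrite permE permM -gv -fv /fg permM permKV permM translE.
Qed.
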